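(* Let $Q\subset\mathbb{R}^2$ be a billiard table and suppose that the mathematical billiard in $Q$ has a period-two orbit of length $L$ (the distance between its two ends) bouncing between regular points $q_1,q_2$ of two focusing boundary components, with radii of curvature $R_1$ at $q_1$ and $R_2$ at $q_2$, where $R_1>R_2$. Suppose that $L<R_1+R_2$, $L>R_1$, $L>R_2$ (so the orbit is linearly stable) and $L<2R_2$. For $0<r<L/2$ consider the corresponding period-two orbit of the physical billiard in $Q$ with a particle of radius $r$. Then this orbit is linearly stable if $r<L-R_1$, it is unstable if $L-R_1<r<L-R_2$, and it is again linearly stable if $L-R_2<r<L/2$.
   Context: A billiard table is a domain $Q\subset\mathbb{R}^2$ whose boundary consists of finitely many $C^2$ curves called regular components; interior points of these are regular points. A regular component is focusing if it is convex outwards of $Q$ (curvature everywhere positive). The mathematical billiard in $Q$ is the motion of a point particle moving uniformly inside $Q$ with elastic reflections off the boundary. The physical billiard in $Q$ with radius $r>0$ is the motion of a hard disk of radius $r$ inside $Q$ with elastic reflections off the boundary. Following the center of the disk, it is equivalent to the mathematical billiard in the reduced table, i.e. the set of possible positions of the center, obtained by moving the boundary points by $r$ along the inner unit normal vectors. The billiard map sends each state immediately after a reflection to the state immediately after the next reflection. It is assumed that the orbit persists for the radius $r$ considered: the segment obtained from $q_1q_2$ by removing length $r$ at each end is a period-two orbit of the mathematical billiard in the reduced table, reflecting off the curves parallel at distance $r$ to the original components. Billiard tables are assumed to satisfy Condition NIC (no internal corners): for every pair of intersecting regular components of $\partial Q$, either all straight segments joining a point of one of them to a point of the other are contained in $Q$,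 or the two components have a common tangent at their point of intersection. A period-two orbit is linearly stable if the derivative of the second iterate of the billiard map along it has complex conjugate eigenvalues on the unit circle different from $\pm1$, and unstable if this derivative has an eigenvalue of modulus greater than $1$. Linear stability is equivalent, for an orbit of length $\ell$ between boundary points with curvatures $k_0,k_1$ (positive for focusing components), to $\ell k_0k_1-k_0-k_1<0$ and $(\ell k_0-1)(\ell k_1-1)>0$. *)

(* Defs.v *)
From HB Require Import structures.
From mathcomp Require Import all_boot all_order all_algebra.
From mathcomp Require Import all_classical all_reals all_analysis.
From mathcomp Require Export complex.
Set Implicit Arguments.
Unset Strict Implicit.
Unset Printing Implicit Defensive.
Import Order.TTheory GRing.Theory Num.Theory numFieldNormedType.Exports.
Local Open Scope classical_set_scope.
Local Open Scope ring_scope.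

Section Plane.
Variable R : realType.
Implicit Types u v : 'rV[R]_2.

Definition vec2 (a b : R) : 'rV[R]_2 := \row_(k < 2) if k == 0 then a else b.

Definition dot u v : R := u 0 0 * v 0 0 + u 0 1 * v 0 1.

(* The library norm on 'rV[R]_2 is the sup norm, hence a separate
   Euclidean norm; both induce the same topology. *)
Definition enorm u : R := Num.sqrt (dot u u).

(* Rotation by pi/2, counterclockwise. *)
Definition rot90 u : 'rV[R]_2 := vec2 (- u 0 1) (u 0 0).

Definition open_disk (c : 'rV[R]_2) (r : R) : set 'rV[R]_2 :=
  [set p | enorm (p - c) < r].

Definition boundary (D : set 'rV[R]_2) : set 'rV[R]_2 :=
  closure D `\` interior D.

(* Twice continuously differentiable. *)
Definition C2_curve (c : R -> 'rV[R]_2) : Prop :=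
  [/\ forall s, derivable c s 1,
      forall s, derivable (derive1 c) s 1 &
      continuous (derive1 (derive1 c))].

End Plane.

(* The data needed to run billiard dynamics: an open set, finitely many
   parametrized boundary curves (curve i restricted to [lo i, hi i]) and a unit
   normal field along each of them, pointing into the open set.  The axioms of
   a billiard table are in billiard_table; they are kept apart because the
   reduced table of a billiard table need not satisfy them (its curves
   are in general only C^1, may cross, and parts of them may be cut off). *)
Record table (R : realType) (n : nat) := Table {
  dom : set 'rV[R]_2;
  lo : 'I_n -> R;
  hi : 'I_n -> R;
  curve : 'I_n -> R -> 'rV[R]_2;
  normal : 'I_n -> R -> 'rV[R]_2
}.

(* A state (i, u): a point curve i (u 0 0) of the boundary, together with the
   signed angle u 0 1 from the inner normal to the outgoing velocity. *)
Definition state (R : realType) (n : nat) : Type := ('I_n * 'rV[R]_2)%type.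

Section Tables.
Variables (R : realType) (n : nat).
Implicit Types (T : table R n) (x y z w : state R n) (i j : 'I_n).

(* - A C^2 function on a closed interval extends to a C^2 function on R, so
     components are taken to be C^2 on R; only [lo i, hi i] matters.
   - Components are parametrized by arc length and oriented so that the
     domain lies on their left.
   - Distinct components meet, and a component closes up, only at endpoints.
   - The last clause says that normal is the inner normal, and that the domain
     lies on one side only of its boundary curves. *)
Record billiard_table T : Prop := BilliardTable {
  bt_open : open (dom T);
  bt_connected : connected (dom T);
  bt_nonempty : dom T !=set0;
  bt_interval : forall i, lo T i < hi T i;
  bt_C2 : forall i, C2_curve (curve T i);
  bt_arclength : forall i s, s \in `[lo T i, hi T i] ->
    enorm (derive1 (curve T i) s) = 1;
  bt_boundary : boundary (dom T) =
    [set p | exists i s, s \in `[lo T i, hi T i] /\ p = curve T i s];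
  bt_simple : forall i j s t, s \in `]lo T i, hi T i[ ->
    t \in `[lo T j, hi T j] -> curve T i s = curve T j t -> i = j /\ s = t;
  bt_normal : forall i s, s \in `[lo T i, hi T i] ->
    normal T i s = rot90 (derive1 (curve T i) s);
  bt_inner : forall i s, s \in `]lo T i, hi T i[ ->
    \forall e \near 0^'+, dom T (curve T i s + e *: normal T i s) /\
                          ~ dom T (curve T i s - e *: normal T i s)
}.

(* Condition NIC.  The table is an open set here, so segments between
   boundary points are required to lie in its closure. *)
Definition no_internal_corners T : Prop :=
  forall i j, i <> j ->
    (exists s t, [/\ s \in `[lo T i, hi T i], t \in `[lo T j, hi T j] &
                     curve T i s = curve T j t]) ->
    (forall s t a, s \in `[lo T i, hi T i] -> t \in `[lo T j, hi T j] ->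
       0 <= a <= 1 ->
       closure (dom T) ((1 - a) *: curve T i s + a *: curve T j t))
    \/
    (forall s t, s \in `[lo T i, hi T i] -> t \in `[lo T j, hi T j] ->
       curve T i s = curve T j t ->
       exists k : R, derive1 (curve T i) s = k *: derive1 (curve T j) t).

(* Signed curvature, for arc length parametrizations; it is positive where the
   curve bends towards the inner normal. *)
Definition curvature T i (s : R) : R :=
  dot (derive1 (derive1 (curve T i)) s) (normal T i s).

Definition radius_of_curvature T i (s : R) : R := (curvature T i s)^-1.

Definition focusing T i : Prop :=
  forall s, s \in `[lo T i, hi T i] -> 0 < curvature T i s.

(* An interior point of component i, in a neighbourhood of which the boundary
   is the component near the parameter s.  In a billiard_table the last two
   clauses follow from the first; in a reduced table they exclude corners and
   the parts of the parallel curves that are not on the boundary. *)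
Definition regular_point T i (s : R) : Prop :=
  [/\ s \in `]lo T i, hi T i[,
      \forall t \near s, boundary (dom T) (curve T i t) &
      forall d : R, 0 < d ->
        \forall p \near curve T i s, boundary (dom T) p ->
          exists2 t, `|t - s| < d & p = curve T i t].

Definition position T x : 'rV[R]_2 := curve T x.1 (x.2 0 0).

Definition inner_normal T x : 'rV[R]_2 := normal T x.1 (x.2 0 0).

(* The vector - rot90 m, for m the inner normal, is the unit tangent in the
   direction of the parametrization of a billiard_table. *)
Definition velocity T x : 'rV[R]_2 :=
  cos (x.2 0 1) *: inner_normal T x + sin (x.2 0 1) *: - rot90 (inner_normal T x).

Definition phase_space T : set (state R n) :=
  [set x : state R n | regular_point T x.1 (x.2 0 0) /\ - (pi / 2) < x.2 0 1 < pi / 2].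

(* Elastic reflection of the velocity v off the line orthogonal to the unit
   vector m. *)
Definition reflection (m v : 'rV[R]_2) : 'rV[R]_2 := v - (2 * dot v m) *: m.

(* The graph of the billiard map of T: z is the state immediately after the
   next reflection following the state x. *)
Definition billiard_map T x z : Prop :=
  [/\ phase_space T x, phase_space T z,
      exists2 l : R, 0 < l &
        position T z = position T x + l *: velocity T x /\
        (forall a, 0 < a < l -> dom T (position T x + a *: velocity T x)) &
      velocity T z = reflection (inner_normal T z) (velocity T x)].

Definition billiard_map2 T x w : Prop :=
  exists2 z, billiard_map T x z & billiard_map T z w.

Definition period_two_orbit T x y : Prop :=
  billiard_map T x y /\ billiard_map T y x.

(* A is the derivative at x of the second iterate of the billiard map, in the
   coordinates (parameter, angle) on the component of x.  Eigenvalues at a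
   period-two point do not depend on this choice of coordinates. *)
Definition derivative2 T x (A : 'M[R]_2) : Prop :=
  exists G : 'rV[R]_2 -> 'rV[R]_2,
    [/\ \forall u \near x.2, forall w,
          billiard_map2 T (x.1, u) w <-> w = (x.1, G u),
        differentiable G x.2 &
        jacobian G x.2 = A].

Definition complex_eigenvalue (A : 'M[R]_2) (z : R[i]) : Prop :=
  eigenvalue (map_mx (real_complex R) A) z.

Definition linearly_stable T x : Prop :=
  exists2 A, derivative2 T x A &
    exists z : R[i], [/\ complex_eigenvalue A z, complex_eigenvalue A z^*%C,
                         `|z| = 1, z <> 1 & z <> -1].

Definition unstable T x : Prop :=
  exists2 A, derivative2 T x A &
    exists z : R[i], complex_eigenvalue A z /\ 1 < `|z|.

(* The reduced table: the possible positions of the center of a disk of radius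
   r that stays inside T.  A state of the reduced table carries the boundary
   parameter of the point where the disk touches the original table. *)
Definition reduced_table T (r : R) : table R n :=
  {| dom := interior [set c | open_disk c r `<=` dom T];
     lo := lo T;
     hi := hi T;
     curve := fun i s => curve T i s + r *: normal T i s;
     normal := normal T |}.

End Tables.

(* Main.v *)
Require Import Defs.
From HB Require Import structures.
From mathcomp Require Import all_boot all_order all_algebra.
From mathcomp Require Import all_classical all_reals all_analysis.
From mathcomp Require Import ring lra.
Set Implicit Arguments.
Unset Strict Implicit.
Unset Printing Implicit Defensive.
Import Order.TTheory GRing.Theory Num.Theory numFieldNormedType.Exports.
Local Open Scope classical_set_scope.
Local Open Scope ring_scope.

(* The velocities of a period-two orbit are normal to the table at both ends,
   so the two ends of the reduced orbit lie on a common normal, at distance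
   l = L - 2 r.  Write k for the curvature of the original table at an end,
   b = 1 - r k for the speed of the parallel curve there, and a = b - l k.  The
   ray leaving a nearby state hits the opposite curve in one point, which
   depends differentiably on the state at the orbit; implicit differentiation
   gives, for the parameter s and the angle theta at one end (x) and s', theta'
   at the other (y),
     ds' = - (a_x ds + l dtheta) / b_y,
     dtheta' = k_x ds - dtheta - k_y ds'.
   The derivative of the second iterate has determinant 1 and trace 4 p - 2 with
     p = a_x a_y / (b_x b_y)
       = (R1 + r - L) (R2 + r - L) / ((R1 - r) (R2 - r)).
   The orbit is linearly stable for 0 < p < 1 and unstable for p < 0; the sign
   of p changes at r = L - R1 and at r = L - R2, and where p > 0 the inequality
   p < 1 follows from L < R1 + R2 (r < L - R1) or from r < L / 2 (r > L - R2). *)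

(** * Two-by-two matrices *)

Lemma ord2P (j : 'I_2) : j = 0 \/ j = 1.
Proof. by case: j => [[|[|//]] p]; [left|right]; apply: val_inj. Qed.

Lemma row2P (T : Type) (u v : 'rV[T]_2) :
  u 0 0 = v 0 0 -> u 0 1 = v 0 1 -> u = v.
Proof. by move=> h0 h1; apply/rowP => j; case: (ord2P j) => ->. Qed.

Lemma sum_ord2 (V : zmodType) (f : 'I_2 -> V) : \sum_j f j = f 0 + f 1.
Proof.
by rewrite big_ord_recr big_ord1 /=; congr (f _ + f _); apply: val_inj.
Qed.

Lemma mxtrace2 (F : nzRingType) (A : 'M[F]_2) : \tr A = A 0 0 + A 1 1.
Proof. exact: sum_ord2. Qed.

(** The characteristic polynomial is monic of size 3, and its two lower coefficients are the
    determinant and minus the trace. *)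
Lemma eigenvalue_mx2 (F : fieldType) (A : 'M[F]_2) (a : F) :
  eigenvalue A a = (a ^+ 2 - \tr A * a + \det A == 0).
Proof.
rewrite eigenvalue_root_char rootE; congr (_ == 0).
rewrite horner_coef size_char_poly !big_ord_recr big_ord0 /= add0r.
rewrite expr0 mulr1 expr1.
have -> : (char_poly A)`_0 = \det A by rewrite char_poly_det sqrrN expr1n mul1r.
have -> : (char_poly A)`_1 = - \tr A by rewrite -(char_poly_trace A).
have -> : (char_poly A)`_2 = 1.
  by have := char_poly_monic A; rewrite monicE lead_coefE size_char_poly => /eqP.
by rewrite mul1r; ring.
Qed.

Lemma det_mx2 (F : comNzRingType) (A : 'M[F]_2) :
  \det A = A 0 0 * A 1 1 - A 0 1 * A 1 0.
Proof.
rewrite (expand_det_row A 0) sum_ord2 /cofactor !det_mx11 !mxE.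
have -> : lift 0 (0 : 'I_1) = 1 :> 'I_2 by apply: val_inj.
have -> : lift 1 (0 : 'I_1) = 0 :> 'I_2 by apply: val_inj.
by rewrite expr0 mul1r /= add0n expr1 mulN1r mulrN.
Qed.

Lemma complex_eigenvalue_mx2 (R : realType) (A : 'M[R]_2) (z : R[i]) :
  \det A = 1 ->
  complex_eigenvalue A z <-> z ^+ 2 - (\tr A)%:C%C * z + 1 = 0.
Proof.
move=> dA; rewrite /complex_eigenvalue eigenvalue_mx2 det_map_mx dA rmorph1.
rewrite trace_map_mx; by split => /eqP.
Qed.

(** The discriminant t^2 - 4 of z^2 - t z + 1 is negative, so the roots are conjugate and not real;
    their product 1 puts them on the unit circle. *)
Lemma conj_eigenvalues_mx2 (R : realType) (A : 'M[R]_2) :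
  \det A = 1 -> -2 < \tr A < 2 ->
  exists z : R[i], [/\ complex_eigenvalue A z, complex_eigenvalue A z^*%C,
                       `|z| = 1, z <> 1 & z <> -1].
Proof.
move=> dA /andP[ltA gtA]; set t := \tr A.
pose b := Num.sqrt (1 - t ^+ 2 / 4).
have b2 : b ^+ 2 = 1 - t ^+ 2 / 4 by rewrite sqr_sqrtr// /t; nra.
have b0 : 0 < b by rewrite sqrtr_gt0 /t; nra.
exists (t / 2 +i* b)%C; split.
- apply/complex_eigenvalue_mx2 => //; rewrite -/t expr2.
  by apply/eqP; rewrite eq_complex /=; apply/andP; split; apply/eqP; nra.
- apply/complex_eigenvalue_mx2 => //; rewrite -/t expr2.
  by apply/eqP; rewrite eq_complex /=; apply/andP; split; apply/eqP; nra.
- rewrite normc_def /= b2; congr (_%:C)%C.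
  by rewrite -[RHS]sqrtr1; congr Num.sqrt; field.
- by move=> /eqP; rewrite eq_complex /= (gt_eqF b0) andbF.
- by move=> /eqP; rewrite eq_complex /= oppr0 (gt_eqF b0) andbF.
Qed.

(** Here the discriminant is positive and the roots are real; for t < -2 the smaller one lies below
    -1. *)
Lemma expanding_eigenvalue_mx2 (R : realType) (A : 'M[R]_2) :
  \det A = 1 -> \tr A < -2 ->
  exists z : R[i], complex_eigenvalue A z /\ 1 < `|z|.
Proof.
move=> dA ltA; set t := \tr A.
pose d := Num.sqrt (t ^+ 2 - 4).
have d2 : d ^+ 2 = t ^+ 2 - 4 by rewrite sqr_sqrtr// /t; nra.
have d0 : 0 <= d by exact: sqrtr_ge0.
exists (((t - d) / 2)%:C)%C; split.
  apply/complex_eigenvalue_mx2 => //; rewrite -/t expr2.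
  by apply/eqP; rewrite eq_complex /=; apply/andP; split; apply/eqP; nra.
rewrite normc_def /= expr0n addr0 sqrtr_sqr -(rmorph1 (real_complex R)) ltcR.
by rewrite ltr0_norm; rewrite /t in d2 *; nra.
Qed.

(** * Limits and differentiation on the plane *)

Lemma vec2E0 (R : realType) (a b : R) : vec2 a b 0 0 = a.
Proof. by rewrite mxE. Qed.

Lemma vec2E1 (R : realType) (a b : R) : vec2 a b 0 1 = b.
Proof. by rewrite mxE. Qed.

Definition vec2E := (vec2E0, vec2E1).

Lemma cvg_row2 (R : realType) (T : Type) (F : set_system T) {FF : Filter F}
    (f : T -> 'rV[R]_2) (l : 'rV[R]_2) :
  f x 0 0 @[x --> F] --> l 0 0 -> f x 0 1 @[x --> F] --> l 0 1 ->
  f x @[x --> F] --> l.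
Proof.
move=> /cvgrPdist_lt f0 /cvgrPdist_lt f1; apply/cvgrPdist_lt => e e0.
near=> x.
rewrite [ltLHS]/Num.Def.normr/= mx_normrE (bigmax_lt _ e0)//= => -[i j] _.
rewrite !mxE (ord1 i) /=.
by case: (ord2P j) => ->; near: x; [apply: f0|apply: f1].
Unshelve. all: by end_near. Qed.

Lemma cvg_row2_coord (R : realType) (T : Type) (F : set_system T)
    {FF : Filter F} (f : T -> 'rV[R]_2) (l : 'rV[R]_2) (j : 'I_2) :
  f x @[x --> F] --> l -> f x 0 j @[x --> F] --> l 0 j.
Proof. by move=> fl; apply: (continuous_cvg _ (@coord_continuous _ 1 2 0 j l)). Qed.

(* Instances of the library lemmas at a neighbourhood filter: with a general
   filter, unification unfolds the neighbourhoods of a row vector. *)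
Section limits.
Variables (R : realType) (T : topologicalType) (t : T).
Implicit Types (f g : T -> R) (a b : R).

Lemma limD f g a b : f x @[x --> t] --> a -> g x @[x --> t] --> b ->
  f x + g x @[x --> t] --> a + b.
Proof. exact: cvgD. Qed.

Lemma limN f a : f x @[x --> t] --> a -> - f x @[x --> t] --> - a.
Proof. exact: cvgN. Qed.

Lemma limB f g a b : f x @[x --> t] --> a -> g x @[x --> t] --> b ->
  f x - g x @[x --> t] --> a - b.
Proof. exact: cvgB. Qed.

Lemma limM f g a b : f x @[x --> t] --> a -> g x @[x --> t] --> b ->
  f x * g x @[x --> t] --> a * b.
Proof. exact: cvgM. Qed.

Lemma lim_cst a : (fun=> a) x @[x --> t] --> a.
Proof. exact: cvg_cst. Qed.

Lemma lim_near f g a : (\forall x \near t, f x = g x) ->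
  g x @[x --> t] --> a -> f x @[x --> t] --> a.
Proof.
move=> fg; apply: cvg_trans; apply: near_eq_cvg; apply: filterS fg => x ->//.
Qed.

Lemma lim_vec2 f g a b : f x @[x --> t] --> a -> g x @[x --> t] --> b ->
  vec2 (f x) (g x) @[x --> t] --> vec2 a b.
Proof.
move=> fa gb; apply: cvg_row2; rewrite vec2E.
  by rewrite (_ : (fun x => _) = f) //; apply/funext => x; rewrite vec2E.
by rewrite (_ : (fun x => _) = g) //; apply/funext => x; rewrite vec2E.
Qed.

Lemma lim_comp (U W : topologicalType) (k : T -> U) (h : U -> W) (u : U) (a : W) :
  k x @[x --> t] --> u -> h y @[y --> u] --> a -> h (k x) @[x --> t] --> a.
Proof. by move=> ku hu; exact: cvg_comp ku hu. Qed.

Lemma lim_lt f a b : f x @[x --> t] --> a -> a < b -> \forall x \near t, f x < b.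
Proof. by move=> fa ab; exact: (cvgr_lt _ fa). Qed.

Lemma lim_gt f a b : f x @[x --> t] --> a -> b < a -> \forall x \near t, b < f x.
Proof. by move=> fa ab; exact: (cvgr_gt _ fa). Qed.

Lemma lim_row2 (f : T -> 'rV[R]_2) (v : 'rV[R]_2) :
  f x 0 0 @[x --> t] --> v 0 0 -> f x 0 1 @[x --> t] --> v 0 1 ->
  f x @[x --> t] --> v.
Proof. exact: cvg_row2. Qed.

Lemma lim_dist f a : (forall e, 0 < e -> \forall x \near t, `|f x - a| <= e) ->
  f x @[x --> t] --> a.
Proof.
move=> fa; apply/cvgrPdist_le => e e0.
by apply: filterS (fa _ e0) => x; rewrite distrC.
Qed.

Lemma near_dist f a e : f x @[x --> t] --> a -> 0 < e ->
  \forall x \near t, `|f x - a| < e.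
Proof.
move=> /cvgrPdist_lt fa e0.
by apply: filterS (fa _ e0) => x; rewrite distrC.
Qed.

Lemma near_always (P : T -> Prop) : (forall x, P x) -> \forall x \near t, P x.
Proof. exact: nearW. Qed.

Lemma near_imp (P P' : T -> Prop) : (forall x, P x -> P' x) ->
  (\forall x \near t, P x) -> \forall x \near t, P' x.
Proof. by move=> PP'; exact: filterS. Qed.

End limits.

(** * Differential calculus in two variables *)

Section cdiff.
Variable R : realType.
Implicit Types (f g : 'rV[R]_2 -> R) (a u : 'rV[R]_2).

(* Differentiability in Caratheodory's form, with partial derivatives d0, d1:
   the rules of calculus become algebraic identities. *)
Definition cdiff f a (d0 d1 : R) : Prop :=
  exists p q : 'rV[R]_2 -> R,
    [/\ p u @[u --> a] --> d0, q u @[u --> a] --> d1 &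
        \forall u \near a,
          f u = f a + p u * (u 0 0 - a 0 0) + q u * (u 0 1 - a 0 1)].

Lemma coord_cvg a j : (u : 'rV[R]_2) 0 j @[u --> a] --> a 0 j.
Proof. exact: coord_continuous. Qed.

Lemma cdiff_eq f a d0 d1 e0 e1 :
  cdiff f a d0 d1 -> d0 = e0 -> d1 = e1 -> cdiff f a e0 e1.
Proof. by move=> + <- <-. Qed.

Lemma cdiff_near f g a d0 d1 :
  (\forall u \near a, f u = g u) -> cdiff f a d0 d1 -> cdiff g a d0 d1.
Proof.
move=> fg [p [q [pd qd fE]]]; exists p, q; split => //.
near=> u; rewrite -(nbhs_singleton fg); have <- : f u = g u by near: u.
by near: u.
Unshelve. all: by end_near. Qed.

Lemma cdiff_cvg f a d0 d1 : cdiff f a d0 d1 -> f u @[u --> a] --> f a.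
Proof.
move=> [p [q [pd qd fE]]].
have E : f a + d0 * (a 0 0 - a 0 0) + d1 * (a 0 1 - a 0 1) = f a.
  by rewrite !subrr !mulr0 !addr0.
rewrite -[X in _ --> X]E.
have : f a + p u * (u 0 0 - a 0 0) + q u * (u 0 1 - a 0 1) @[u --> a] -->
    f a + d0 * (a 0 0 - a 0 0) + d1 * (a 0 1 - a 0 1).
  have c j : (u : 'rV[R]_2) 0 j - a 0 j @[u --> a] --> a 0 j - a 0 j.
    apply: limB; [exact: coord_cvg|exact: lim_cst].
  apply: limD; [apply: limD; [exact: lim_cst|]|];
    by apply: limM => //; exact: c.
exact: lim_near.
Qed.

Lemma cdiff_coord0 a : cdiff (fun u => u 0 0) a 1 0.
Proof.
exists (cst 1), (cst 0); split; try exact: lim_cst.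
by apply: near_always => u /=; ring.
Qed.

Lemma cdiff_coord1 a : cdiff (fun u => u 0 1) a 0 1.
Proof.
exists (cst 0), (cst 1); split; try exact: lim_cst.
by apply: near_always => u /=; ring.
Qed.

Lemma cdiff_cst (c : R) a : cdiff (fun=> c) a 0 0.
Proof.
exists (cst 0), (cst 0); split; try exact: lim_cst.
by apply: near_always => u /=; ring.
Qed.

Lemma cdiffD f g a d0 d1 e0 e1 : cdiff f a d0 d1 -> cdiff g a e0 e1 ->
  cdiff (fun u => f u + g u) a (d0 + e0) (d1 + e1).
Proof.
move=> [p [q [pd qd fE]]] [r [s [re se gE]]].
exists (fun u => p u + r u), (fun u => q u + s u); split; try exact: limD.
near=> u; have -> : f u = f a + p u * (u 0 0 - a 0 0) + q u * (u 0 1 - a 0 1).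
  by near: u.
have -> : g u = g a + r u * (u 0 0 - a 0 0) + s u * (u 0 1 - a 0 1).
  by near: u.
by ring.
Unshelve. all: by end_near. Qed.

Lemma cdiffN f a d0 d1 : cdiff f a d0 d1 ->
  cdiff (fun u => - f u) a (- d0) (- d1).
Proof.
move=> [p [q [pd qd fE]]].
exists (fun u => - p u), (fun u => - q u); split; try exact: limN.
near=> u; have -> : f u = f a + p u * (u 0 0 - a 0 0) + q u * (u 0 1 - a 0 1).
  by near: u.
by ring.
Unshelve. all: by end_near. Qed.

Lemma cdiffB f g a d0 d1 e0 e1 : cdiff f a d0 d1 -> cdiff g a e0 e1 ->
  cdiff (fun u => f u - g u) a (d0 - e0) (d1 - e1).
Proof. by move=> df dg; apply: cdiffD => //; apply: cdiffN. Qed.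

Lemma cdiffM f g a d0 d1 e0 e1 : cdiff f a d0 d1 -> cdiff g a e0 e1 ->
  cdiff (fun u => f u * g u) a (d0 * g a + f a * e0) (d1 * g a + f a * e1).
Proof.
move=> df dg; have gc := cdiff_cvg dg.
case: df => p [q [pd qd fE]]; case: dg => r [s [re se gE]].
exists (fun u => p u * g u + f a * r u), (fun u => q u * g u + f a * s u).
split; try by apply: limD; apply: limM => //; exact: lim_cst.
near=> u; have -> : f u = f a + p u * (u 0 0 - a 0 0) + q u * (u 0 1 - a 0 1).
  by near: u.
have : g u = g a + r u * (u 0 0 - a 0 0) + s u * (u 0 1 - a 0 1) by near: u.
move=> gu; rewrite [in LHS]mulrDl [in LHS]mulrDl {1}gu; ring.
Unshelve. all: by end_near. Qed.

(* A continuous factor suffices where the other one vanishes. *)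
Lemma cdiffM_cvg f g a d0 d1 c : cdiff f a d0 d1 -> f a = 0 ->
  g u @[u --> a] --> c -> cdiff (fun u => f u * g u) a (d0 * c) (d1 * c).
Proof.
move=> [p [q [pd qd fE]]] fa gc.
exists (fun u => p u * g u), (fun u => q u * g u); split; try exact: limM.
near=> u; have -> : f u = f a + p u * (u 0 0 - a 0 0) + q u * (u 0 1 - a 0 1).
  by near: u.
by rewrite fa; ring.
Unshelve. all: by end_near. Qed.

Lemma cdiff_comp1 f (h : R -> R) a d0 d1 e :
  cdiff f a d0 d1 -> is_derive (f a) 1 h e ->
  cdiff (fun u => h (f u)) a (e * d0) (e * d1).
Proof.
move=> df /is_derive1_caratheodory [k [hE kc ke]]; have fc := cdiff_cvg df.
have kf : k (f u) @[u --> a] --> e.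
  by rewrite -ke; apply: lim_comp fc kc.
case: df => p [q [pd qd fE]].
exists (fun u => k (f u) * p u), (fun u => k (f u) * q u).
split; try exact: limM.
near=> u; rewrite -[h (f u)](subrK (h (f a))) hE.
have {2}-> : f u = f a + p u * (u 0 0 - a 0 0) + q u * (u 0 1 - a 0 1).
  by near: u.
by ring.
Unshelve. all: by end_near. Qed.

Lemma cdiff_fst (h : R -> R) a e :
  is_derive (a 0 0) 1 h e -> cdiff (fun u => h (u 0 0)) a e 0.
Proof.
move=> dh; apply: cdiff_eq (cdiff_comp1 (cdiff_coord0 a) dh) _ _;
  by rewrite ?mulr1 ?mulr0.
Qed.

Lemma cdiff_snd (h : R -> R) a e :
  is_derive (a 0 1) 1 h e -> cdiff (fun u => h (u 0 1)) a 0 e.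
Proof.
move=> dh; apply: cdiff_eq (cdiff_comp1 (cdiff_coord1 a) dh) _ _;
  by rewrite ?mulr1 ?mulr0.
Qed.

(** The chain rule that composes the two flights of the orbit. The slope factors of F, taken along
    the inner pair, multiply those of f and g. *)
Lemma cdiff_comp2 (F f g : 'rV[R]_2 -> R) a F0 F1 d0 d1 e0 e1 :
  cdiff f a d0 d1 -> cdiff g a e0 e1 -> cdiff F (vec2 (f a) (g a)) F0 F1 ->
  cdiff (fun u => F (vec2 (f u) (g u))) a (F0 * d0 + F1 * e0) (F0 * d1 + F1 * e1).
Proof.
move=> df dg; have fc := cdiff_cvg df; have gc := cdiff_cvg dg.
have fgc : vec2 (f u) (g u) @[u --> a] --> vec2 (f a) (g a).
  exact: lim_vec2.
case: df => p [q [pd qd fE]]; case: dg => r [s [re se gE]].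
move=> [P [Q [PF QF FE]]].
pose v u := vec2 (f u) (g u).
have Pv : P (v u) @[u --> a] --> F0 by apply: lim_comp fgc PF.
have Qv : Q (v u) @[u --> a] --> F1 by apply: lim_comp fgc QF.
exists (fun u => P (v u) * p u + Q (v u) * r u),
       (fun u => P (v u) * q u + Q (v u) * s u).
split; try by apply: limD; apply: limM.
have FvE : \forall u \near a, F (v u) =
    F (v a) + P (v u) * (v u 0 0 - v a 0 0) + Q (v u) * (v u 0 1 - v a 0 1).
  exact: fgc FE.
near=> u.
have : F (v u) =
    F (v a) + P (v u) * (v u 0 0 - v a 0 0) + Q (v u) * (v u 0 1 - v a 0 1).
  by near: u.
rewrite [v u 0 0]vec2E [v a 0 0]vec2E [v u 0 1]vec2E [v a 0 1]vec2E.
rewrite -/(v u) -/(v a) => ->.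
have fu : f u = f a + p u * (u 0 0 - a 0 0) + q u * (u 0 1 - a 0 1).
  by near: u.
have gu : g u = g a + r u * (u 0 0 - a 0 0) + s u * (u 0 1 - a 0 1).
  by near: u.
by rewrite fu gu; ring.
Unshelve. all: by end_near. Qed.

Lemma row2_coord_le (h : 'rV[R]_2) j : `|h 0 j| <= `|h|.
Proof.
rewrite [leRHS]/Num.Def.normr/= mx_normrE.
exact: (le_bigmax _ (fun ij => `|h ij.1 ij.2|) (0, j)).
Qed.

(** The way back to the derivative used in [derivative2]. Row vectors are multiplied by matrices on
    the right, so row k of [M] holds the partial derivatives in coordinate k. *)
Lemma cdiff_differentiable f g a d0 d1 e0 e1 :
  cdiff f a d0 d1 -> cdiff g a e0 e1 ->
  let G u := vec2 (f u) (g u) in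
  let M := \matrix_(i < 2) (if i == 0 then vec2 d0 e0 else vec2 d1 e1) in
  differentiable G a /\ jacobian G a = M.
Proof.
move=> [p [q [pd qd fE]]] [r [s [re se gE]]] G M.
have ME h j : (h *m M) 0 j = h 0 0 * M 0 j + h 0 1 * M 1 j.
  by rewrite mxE sum_ord2.
have Mc : continuous (mulmxr M : 'rV[R]_2 -> 'rV[R]_2).
  have -> : (mulmxr M : 'rV[R]_2 -> 'rV[R]_2) =
      fun h => vec2 (h 0 0 * M 0 0 + h 0 1 * M 1 0) (h 0 0 * M 0 1 + h 0 1 * M 1 1).
    by apply/funext => h; apply: row2P; rewrite vec2E; exact: ME.
  by move=> h; apply: lim_vec2; apply: limD; apply: limM;
    solve [exact: coord_cvg | exact: lim_cst].
pose D : {linear 'rV[R]_2 -> 'rV[R]_2} := mulmxr M.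
(* In each coordinate the remainder is a combination of h 0 0 and h 0 1 whose coefficients tend to
   0; once both are below e / 2, it is at most e times the sup norm of h. *)
have Mo : G \o shift a = cst (G a) + (D : 'rV[R]_2 -> 'rV[R]_2) +o_ (0 : 'rV[R]_2) id.
  apply/eqaddoP => e e0'.
  have e2 : 0 < e / 2 by rewrite divr_gt0.
  have tr (P : set 'rV[R]_2) : (\forall u \near a, P u) ->
      \forall h \near (0 : 'rV[R]_2), P (h + a).
    by rewrite (near_shift 0 a) subr0.
  have bound (h : 'rV[R]_2) (c0 c1 : R) : `|c0| < e / 2 -> `|c1| < e / 2 ->
      `|c0 * h 0 0 + c1 * h 0 1| <= e * `|h|.
    move=> hc0 hc1; apply: le_trans (ler_normD _ _) _; rewrite !normrM.
    rewrite (splitr e) mulrDl; apply: lerD; apply: ler_pM => //;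
      solve [exact: ltW | exact: row2_coord_le].
  have n0 : \forall u \near a, `|p u - d0| < e / 2.
    by move/cvgrPdist_lt : pd => /(_ _ e2); apply: filterS => u; rewrite distrC.
  have n1 : \forall u \near a, `|q u - d1| < e / 2.
    by move/cvgrPdist_lt : qd => /(_ _ e2); apply: filterS => u; rewrite distrC.
  have n2 : \forall u \near a, `|r u - e0| < e / 2.
    by move/cvgrPdist_lt : re => /(_ _ e2); apply: filterS => u; rewrite distrC.
  have n3 : \forall u \near a, `|s u - e1| < e / 2.
    by move/cvgrPdist_lt : se => /(_ _ e2); apply: filterS => u; rewrite distrC.
  move: (tr _ n0) (tr _ n1) (tr _ n2) (tr _ n3) (tr _ fE) (tr _ gE).
  move=> {}n0 {}n1 {}n2 {}n3 {}fE {}gE.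
  near=> h.
  rewrite [leLHS]/Num.Def.normr/= mx_normrE.
  apply: bigmax_le => [|[i j] _]; first by rewrite mulr_ge0 // ltW.
  rewrite (ord1 i) /= [X in `|X|]mxE [X in _ + X]mxE [X in _ - X]mxE ME !fctE.
  case: (ord2P j) => -> /=; rewrite !vec2E [M 0 _]mxE [M 1 _]mxE /= !vec2E.
    have -> : f (h + a) = f a + p (h + a) * ((h + a) 0 0 - a 0 0) +
        q (h + a) * ((h + a) 0 1 - a 0 1) by near: h.
    have -> : (h + a) 0 0 - a 0 0 = h 0 0 by rewrite mxE addrK.
    have -> : (h + a) 0 1 - a 0 1 = h 0 1 by rewrite mxE addrK.
    rewrite [X in `|X|](_ : _ = (p (h + a) - d0) * h 0 0 + (q (h + a) - d1) * h 0 1).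
      by apply: bound; near: h.
    by ring.
  have -> : g (h + a) = g a + r (h + a) * ((h + a) 0 0 - a 0 0) +
      s (h + a) * ((h + a) 0 1 - a 0 1) by near: h.
  have -> : (h + a) 0 0 - a 0 0 = h 0 0 by rewrite mxE addrK.
  have -> : (h + a) 0 1 - a 0 1 = h 0 1 by rewrite mxE addrK.
  rewrite [X in `|X|](_ : _ = (r (h + a) - e0) * h 0 0 + (s (h + a) - e1) * h 0 1).
    by apply: bound; near: h.
  by ring.
have dG : 'd G a = D :> (_ -> _) by exact: diff_unique.
split; first by apply/diff_locallyP; rewrite dG.
apply/row_matrixP => i; rewrite !rowE /jacobian mul_rV_lin1.
by rewrite [LHS](congr1 (fun k => k _) dG).
Unshelve. all: by end_near. Qed.

End cdiff.

(** * Parallel curves *)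

Section plane.
Variable R : realType.
Implicit Types u v w : 'rV[R]_2.

Lemma dotDl u v w : dot (u + v) w = dot u w + dot v w.
Proof. by rewrite /dot !mxE; ring. Qed.

Lemma dotBl u v w : dot (u - v) w = dot u w - dot v w.
Proof. by rewrite /dot !mxE; ring. Qed.

Lemma dotZl a u v : dot (a *: u) v = a * dot u v.
Proof. by rewrite /dot !mxE; ring. Qed.

Lemma dotC u v : dot u v = dot v u.
Proof. by rewrite /dot; ring. Qed.

Lemma dot_rot90 u : dot u (rot90 u) = 0.
Proof. by rewrite /dot !vec2E; ring. Qed.

Lemma dot_rot90_rot90 u v : dot (rot90 u) (rot90 v) = dot u v.
Proof. by rewrite /dot !vec2E; ring. Qed.

Lemma dot_ge0 u : 0 <= dot u u.
Proof. by rewrite /dot -!expr2 addr_ge0 ?sqr_ge0. Qed.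

Lemma enorm_lt u (r : R) : 0 < r -> (enorm u < r) = (dot u u < r ^+ 2).
Proof.
move=> r0; rewrite /enorm -[in RHS](sqr_sqrtr (dot_ge0 u)).
by rewrite ltr_pXn2r // nnegrE ?sqrtr_ge0 // ltW.
Qed.

Lemma enorm1 u : enorm u = 1 -> dot u u = 1.
Proof. by move=> u1; rewrite -(sqr_sqrtr (dot_ge0 u)) [Num.sqrt _]u1 expr1n. Qed.

Lemma lim_dot (T : topologicalType) (t : T) (f g : T -> 'rV[R]_2) u v :
  f x @[x --> t] --> u -> g x @[x --> t] --> v ->
  dot (f x) (g x) @[x --> t] --> dot u v.
Proof.
by move=> fu gv; apply: limD; apply: limM; exact: cvg_row2_coord.
Qed.

Lemma lim_rot90 (T : topologicalType) (t : T) (f : T -> 'rV[R]_2) u :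
  f x @[x --> t] --> u -> rot90 (f x) @[x --> t] --> rot90 u.
Proof.
by move=> fu; apply: lim_vec2; [apply: limN|]; exact: cvg_row2_coord.
Qed.

Lemma lim_coord (T : topologicalType) (t : T) (f : T -> 'rV[R]_2) u j :
  f x @[x --> t] --> u -> f x 0 j @[x --> t] --> u 0 j.
Proof. exact: cvg_row2_coord. Qed.

Lemma lim_addv (T : topologicalType) (t : T) (f g : T -> 'rV[R]_2) u v :
  f x @[x --> t] --> u -> g x @[x --> t] --> v -> f x + g x @[x --> t] --> u + v.
Proof.
move=> fu gv; have E x y : x + y = vec2 (x 0 0 + y 0 0) (x 0 1 + y 0 1) :> 'rV[R]_2.
  by apply: row2P; rewrite mxE vec2E.
rewrite (funext (fun x => E (f x) (g x))) E.
by apply: lim_vec2; apply: limD; exact: lim_coord.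
Qed.

Lemma lim_scalev (T : topologicalType) (t : T) (f : T -> R) (g : T -> 'rV[R]_2) (a : R) v :
  f x @[x --> t] --> a -> g x @[x --> t] --> v -> f x *: g x @[x --> t] --> a *: v.
Proof.
move=> fu gv; have E (x : R) y : x *: y = vec2 (x * y 0 0) (x * y 0 1) :> 'rV[R]_2.
  by apply: row2P; rewrite mxE vec2E.
rewrite (funext (fun x => E (f x) (g x))) E.
by apply: lim_vec2; apply: limM => //; exact: lim_coord.
Qed.

Lemma lim_oppv (T : topologicalType) (t : T) (f : T -> 'rV[R]_2) u :
  f x @[x --> t] --> u -> - f x @[x --> t] --> - u.
Proof.
move=> fu; have E x : - x = vec2 (- x 0 0) (- x 0 1) :> 'rV[R]_2.
  by apply: row2P; rewrite mxE vec2E.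
rewrite (funext (fun x => E (f x))) E.
by apply: lim_vec2; apply: limN; exact: lim_coord.
Qed.

Lemma lim_subv (T : topologicalType) (t : T) (f g : T -> 'rV[R]_2) u v :
  f x @[x --> t] --> u -> g x @[x --> t] --> v -> f x - g x @[x --> t] --> u - v.
Proof. by move=> fu gv; apply: lim_addv => //; exact: lim_oppv. Qed.

Lemma lim_cstv (T : topologicalType) (t : T) u : (fun=> u) x @[x --> t] --> u.
Proof. exact: cvg_cst. Qed.

Lemma lim_id (T : topologicalType) (t : T) : x @[x --> t] --> t.
Proof. exact: cvg_id. Qed.

Lemma frame_eq u v w : dot w w = 1 -> dot u w = dot v w ->
  dot u (rot90 w) = dot v (rot90 w) -> u = v.
Proof.
move=> w1 e0 e1.
have E (z : 'rV[R]_2) : z = dot z w *: w + dot z (rot90 w) *: rot90 w.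
  rewrite -[LHS]scale1r -w1.
  by apply: row2P; rewrite /dot !(vec2E, mxE); ring.
by rewrite [u]E [v]E e0 e1.
Qed.

Lemma is_derive_coord (c : R -> 'rV[R]_2) s j :
  derivable c s 1 -> is_derive s 1 (fun t => c t 0 j) (derive1 c s 0 j).
Proof.
move=> dc; apply: DeriveDef; first by move/derivable_mxP : dc; apply.
by rewrite derive1E derive_mx // mxE.
Qed.

End plane.

(** * Frenet equations and the parallel curve at distance r *)

Section reduced_curves.
Variables (R : realType) (n : nat) (Q : table R n).
Implicit Types (i : 'I_n) (s t : R).
Hypothesis tableQ : billiard_table Q.

Definition tangent i := derive1 (curve Q i).

Definition interior_param i (s : R) := s \in `]lo Q i, hi Q i[.

Lemma near_interior i s :
  interior_param i s -> \forall t \near s, interior_param i t.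
Proof. exact: near_in_itvoo. Qed.

Lemma interior_closed i s :
  interior_param i s -> s \in `[lo Q i, hi Q i].
Proof. by move=> si; exact: subset_itv_oo_cc. Qed.

Lemma normalE i s : interior_param i s -> normal Q i s = rot90 (tangent i s).
Proof. by move=> /interior_closed; exact: bt_normal. Qed.

Lemma tangent1 i s : interior_param i s -> dot (tangent i s) (tangent i s) = 1.
Proof. by move=> /interior_closed si; apply/enorm1/bt_arclength. Qed.

Lemma normal1 i s : interior_param i s -> dot (normal Q i s) (normal Q i s) = 1.
Proof. by move=> si; rewrite normalE // dot_rot90_rot90 tangent1. Qed.

Lemma is_derive_curve i s j :
  is_derive s 1 (fun t => curve Q i t 0 j) (tangent i s 0 j).
Proof. by apply: is_derive_coord; have [] := bt_C2 tableQ i. Qed.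

(** First Frenet equation: the derivative of the unit tangent is orthogonal to it, hence a multiple
    of the normal, and [curvature] is that multiple by definition. *)
Lemma is_derive_tangent i s j : interior_param i s ->
  is_derive s 1 (fun t => tangent i t 0 j) (curvature Q i s * normal Q i s 0 j).
Proof.
move=> si; have [_ d2 _] := bt_C2 tableQ i.
have dt k := is_derive_coord k (d2 s).
have perp : dot (derive1 (tangent i) s) (tangent i s) = 0.
  pose f t := tangent i t 0 0 ^+ 2 + tangent i t 0 1 ^+ 2.
  have df : is_derive s 1 f (2 * dot (derive1 (tangent i) s) (tangent i s)).
    have := dt 0; have := dt 1 => ? ?.
    apply: is_derive_eq; rewrite /dot /GRing.scale /=; ring.
  have df0 : is_derive s 1 f 0.
    have n1 : \forall t \near s, cst 1 t = f t.
      have := near_interior si; apply: filterS => t /tangent1.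
      by rewrite /dot /f !expr2.
    exact: near_eq_is_derive n1 (is_derive_cst _ _ _).
  have := @derive_val _ _ _ _ _ _ _ df; rewrite (@derive_val _ _ _ _ _ _ _ df0).
  lra.
suff <- : derive1 (tangent i) s 0 j = curvature Q i s * normal Q i s 0 j.
  exact: dt.
rewrite /curvature normalE // -/(tangent i).
rewrite -[LHS]mulr1 -(tangent1 si); move: perp; rewrite /dot.
set a := tangent i s; set b := derive1 _ _ => perp.
have p0 : b 0 0 * a 0 0 = - (b 0 1 * a 0 1) by apply/eqP; rewrite -addr_eq0 perp.
case: (ord2P j) => ->; rewrite !vec2E mulrDr.
  by rewrite mulrA p0; ring.
by rewrite [b 0 1 * (a 0 1 * _)]mulrA -[b 0 1 * a 0 1]opprK -p0; ring.
Qed.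

(** Second Frenet equation, obtained by rotating the first. The normal is known to be the rotated
    tangent only on the parameter interval, so the two are compared near an interior parameter. *)
Lemma is_derive_normal i s j : interior_param i s ->
  is_derive s 1 (fun t => normal Q i t 0 j) (- curvature Q i s * tangent i s 0 j).
Proof.
move=> si; have nN := near_interior si.
case: (ord2P j) => ->.
  have n1 : \forall t \near s, - tangent i t 0 1 = normal Q i t 0 0.
    by apply: filterS nN => t ti; rewrite normalE // vec2E.
  apply: near_eq_is_derive n1 _; have dt := is_derive_tangent 1 si.
  by apply: is_derive_eq; rewrite normalE // vec2E mulNr.
have n1 : \forall t \near s, tangent i t 0 0 = normal Q i t 0 1.
  by apply: filterS nN => t ti; rewrite normalE // vec2E.
apply: near_eq_is_derive n1 _; have dt := is_derive_tangent 0 si.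
by apply: is_derive_eq; rewrite normalE // vec2E mulrN mulNr.
Qed.

Variable r : R.
Local Notation T := (reduced_table Q r).

Definition speed i s := 1 - r * curvature Q i s.

Lemma is_derive_rcurve i s j : interior_param i s ->
  is_derive s 1 (fun t => curve T i t 0 j) (speed i s * tangent i s 0 j).
Proof.
move=> si; have dn := is_derive_normal j si; have dc := is_derive_curve i s j.
have -> : (fun t => curve T i t 0 j) =
    (fun t => curve Q i t 0 j + r * normal Q i t 0 j).
  by apply/funext => t; rewrite !mxE.
by apply: is_derive_eq; rewrite /speed /GRing.scale /=; ring.
Qed.

Lemma is_derive_cvg (f : R -> R) s d :
  is_derive s 1 f d -> f t @[t --> s] --> f s.
Proof. by move=> [df _]; apply/differentiable_continuous/derivable1_diffP. Qed.

Lemma lim_tangent i s : interior_param i s -> tangent i t @[t --> s] --> tangent i s.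
Proof.
by move=> si; apply: cvg_row2; apply: is_derive_cvg; exact: is_derive_tangent.
Qed.

Lemma lim_normal i s : interior_param i s -> normal Q i t @[t --> s] --> normal Q i s.
Proof.
by move=> si; apply: cvg_row2; apply: is_derive_cvg; exact: is_derive_normal.
Qed.

Lemma lim_rcurve i s : interior_param i s -> curve T i t @[t --> s] --> curve T i s.
Proof.
by move=> si; apply: cvg_row2; apply: is_derive_cvg; exact: is_derive_rcurve.
Qed.

Lemma lim_curvature i s :
  interior_param i s -> curvature Q i t @[t --> s] --> curvature Q i s.
Proof.
move=> si; apply: lim_dot; last exact: lim_normal.
by have [_ _ cc] := bt_C2 tableQ i; exact: cc.
Qed.

Lemma lim_speed i s : interior_param i s -> speed i t @[t --> s] --> speed i s.
Proof.
move=> si; apply: limB; first exact: lim_cst.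
by apply: limM; [exact: lim_cst|exact: lim_curvature].
Qed.

Lemma tangent_coord_le1 i s j : interior_param i s -> `|tangent i s 0 j| <= 1.
Proof.
move=> /tangent1; rewrite /dot => t1.
by case: (ord2P j) => ->; rewrite ler_norml; apply/andP; split; nra.
Qed.

(* The constants are uniform in the direction, because the direction will vary
   with the state. *)
Lemma rcurve_mono i s (w0 : 'rV[R]_2) :
  interior_param i s -> 0 < speed i s -> 0 < dot (tangent i s) w0 ->
  exists d k : R, [/\ 0 < d, 0 < k,
    forall t, `|t - s| < d -> interior_param i t &
    \forall w \near w0, forall t t', `|t - s| < d -> `|t' - s| < d -> t <= t' ->
      k * (t' - t) <= dot (curve T i t' - curve T i t) w].
Proof.
move=> si b0; set v := dot _ _ => v0.
have v2 : 0 < v / 2 by lra.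
have v8 : 0 < v / 8 by lra.
have b2 : 0 < speed i s / 2 by lra.
have lt : dot (tangent i t) w0 @[t --> s] --> v.
  by apply: lim_dot; [exact: lim_tangent|exact: cvg_cst].
have nt : \forall t \near s, [/\ interior_param i t, speed i s / 2 < speed i t &
    v / 2 < dot (tangent i t) w0].
  move: (near_interior si) => n1.
  move/cvgrPdist_lt : (lim_speed si) => /(_ _ b2) n2.
  move/cvgrPdist_lt : lt => /(_ _ v2) n3.
  near=> t; split; first by near: t.
    have : `|speed i s - speed i t| < speed i s / 2 by near: t.
    by rewrite ltr_norml => /andP[_]; lra.
  have : `|v - dot (tangent i t) w0| < v / 2 by near: t.
  by rewrite ltr_norml => /andP[_]; lra.
move/nbhs_ballP : nt => [d /= d0 nt].
have {}nt t : `|t - s| < d -> [/\ interior_param i t,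
    speed i s / 2 < speed i t & v / 2 < dot (tangent i t) w0].
  by move=> td; apply: nt; rewrite /ball /= distrC.
(* Half the speed at s bounds the speed from below. The factor v / 4 is the bound v / 2 for the
   direction [w0], less at most v / 8 for each coordinate of w - w0, as the coordinates of a unit
   tangent are at most 1. *)
exists d, (speed i s / 2 * (v / 4)); split => //.
- by rewrite mulr_gt0 //; lra.
- by move=> t /nt[].
apply/nbhs_ballP; exists (v / 8) => //= w ww t t' ts t's.
have ww0 j : `|(w - w0) 0 j| < v / 8.
  by case: ww => _ /(_ 0 j); rewrite !mxE distrC.
rewrite le_eqVlt => /predU1P[<-|tt'].
  by rewrite !subrr mulr0 /dot !mxE !mul0r addr0.
pose f x := dot (curve T i x) w.
have inside x : x \in `[t, t'] -> `|x - s| < d.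
  rewrite in_itv /= => /andP[tx xt']; move: ts t's; rewrite !ltr_norml.
  by move=> /andP[? ?] /andP[? ?]; apply/andP; split; lra.
have df x : x \in `[t, t'] -> is_derive x 1 f (speed i x * dot (tangent i x) w).
  move=> /inside/nt[xi _ _].
  have d0' := is_derive_rcurve 0 xi; have d1' := is_derive_rcurve 1 xi.
  by apply: is_derive_eq; rewrite /dot /GRing.scale /=; ring.
have cf : {within `[t, t'], continuous f}.
  by apply: derivable_within_continuous => x /df[].
have dfo x : x \in `]t, t'[ -> is_derive x 1 f (speed i x * dot (tangent i x) w).
  by move=> xt; apply: df; exact: subset_itv_oo_cc.
have [x xt] := MVT tt' dfo cf.
rewrite /f -dotBl => ->; rewrite ler_pM2r ?subr_gt0 //.
have /inside/nt[xi bx vx] : x \in `[t, t'] by exact: subset_itv_oo_cc.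
apply: ler_pM; [lra|lra|exact: ltW|].
have -> : w = w0 + (w - w0) by rewrite addrC subrK.
rewrite dotC dotDl dotC; apply: le_trans (_ : v / 2 - v / 4 <= _); first lra.
apply: lerD; first exact: ltW.
have : `|dot (w - w0) (tangent i x)| <= v / 4.
  rewrite /dot; apply: le_trans (ler_normD _ _) _; rewrite !normrM.
  have M j : `|(w - w0) 0 j| * `|tangent i x 0 j| <= v / 8.
    by rewrite -[leRHS]mulr1 ler_pM // ?(ltW (ww0 j)) // tangent_coord_le1.
  by have := M 0; have := M 1; lra.
by rewrite ler_norml => /andP[].
Unshelve. all: by end_near. Qed.

(** One radius d at s serves every radius e at a nearby t: boundary points near [curve T i t] have a
    parameter within d of s, and there the curve advances along the tangent at s with slope at least
    k, so a displacement below k e forces parameters within e. *)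
Lemma regular_point_near i s : regular_point T i s -> 0 < speed i s ->
  \forall t \near s, regular_point T i t.
Proof.
move=> [si bs rs] b0.
have ts : 0 < dot (tangent i s) (tangent i s) by rewrite tangent1.
have [d [k [d0 k0 id mono]]] := rcurve_mono si b0 ts.
have {}mono := nbhs_singleton mono.
have Ps : \forall t \near s, \forall p \near curve T i t, boundary (dom T) p ->
    exists2 t, `|t - s| < d & p = curve T i t.
  exact: (lim_rcurve si (near_join (rs _ d0))).
have Bs : \forall t \near s, \forall t' \near t, boundary (dom T) (curve T i t').
  exact: near_join bs.
have Ds : \forall t \near s, `|t - s| < d.
  by apply/nbhs_ballP; exists d => //= t; rewrite /ball /= distrC.
near=> t; have ti : interior_param i t by near: t; exact: near_interior.
split => //; first by near: t.
move=> e e0; have td : `|t - s| < d by near: t.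
have ke : 0 < k * e by rewrite mulr_gt0.
have Pt : \forall p \near curve T i t, boundary (dom T) p ->
    exists2 t, `|t - s| < d & p = curve T i t by near: t.
have Qt : \forall p \near curve T i t,
    `|dot (p - curve T i t) (tangent i s)| < k * e.
  have : dot (p - curve T i t) (tangent i s) @[p --> curve T i t] -->
      dot (curve T i t - curve T i t) (tangent i s).
    apply: lim_dot; last exact: lim_cstv.
    by apply: lim_subv; [exact: lim_id|exact: lim_cstv].
  have -> : dot (curve T i t - curve T i t) (tangent i s) = 0.
    by rewrite dotBl subrr.
  move=> /cvgrPdist_lt /(_ _ ke) H; near=> p.
  by rewrite -normrN -sub0r; near: p.
near=> p => bp; have [t' t's pE] : exists2 t, `|t - s| < d & p = curve T i t.
  by move: bp; near: p.
exists t' => //; rewrite -(ltr_pM2l k0).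
have : `|dot (p - curve T i t) (tangent i s)| < k * e by near: p.
rewrite pE; apply: le_lt_trans.
have [tt'|t't] := leP t t'.
  by rewrite ger0_norm ?subr_ge0 //; apply: le_trans (ler_norm _); exact: mono.
rewrite distrC ger0_norm ?subr_ge0 ?(ltW t't) // -normrN -[- dot _ _]mulN1r -dotZl.
by rewrite scaleN1r opprB; apply: le_trans (ler_norm _); apply: mono => //; exact: ltW.
Unshelve. all: by end_near. Qed.

End reduced_curves.
(** * The billiard map of the reduced table *)

Section reduced_table.
Variables (R : realType) (n : nat) (Q : table R n).
Hypothesis tableQ : billiard_table Q.
Variable r : R.
Hypothesis r0 : 0 < r.
Local Notation T := (reduced_table Q r).
Implicit Types (i : 'I_n) (s t a : R) (p v q : 'rV[R]_2) (x y z : state R n).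

Lemma open_dom : open (dom T).
Proof. exact: open_interior. Qed.

Lemma boundaryP p : boundary (dom T) p <-> closure (dom T) p /\ ~ dom T p.
Proof. by rewrite /boundary (interior_id _).1 //; exact: open_dom. Qed.

Lemma position_boundary x : phase_space T x -> boundary (dom T) (position T x).
Proof. by move=> [[_ bx _] _]; exact: nbhs_singleton bx. Qed.

(** The part of the open segment inside the table is relatively open. It is also relatively closed,
    since a point of the closure outside the table would be a boundary point. The segment is
    connected. *)
Lemma segment_in_dom p v l : (forall a, 0 < a < l -> ~ boundary (dom T) (p + a *: v)) ->
  (exists2 a, 0 < a < l & dom T (p + a *: v)) ->
  forall a, 0 < a < l -> dom T (p + a *: v).
Proof.
move=> nb [a0 a0l da0]; pose A := (fun a => p + a *: v) @` `]0, l[%classic.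
have cA : connected A.
  apply: connected_continuous_connected.
    by apply/connected_intervalP; exact: interval_is_interval.
  apply: continuous_subspaceT => a; apply: lim_addv; first exact: lim_cstv.
  by apply: lim_scalev; [exact: lim_id|exact: lim_cstv].
have AE : A `&` dom T = A.
  apply: cA.
  - by exists (p + a0 *: v); split => //; exists a0 => //=; rewrite in_itv.
  - by exists (dom T) => //; exact: open_dom.
  - exists (closure (dom T)); first exact: closed_closure.
    rewrite predeqE => q; split=> -[Aq dq]; split => //.
      exact: subset_closure.
    case: Aq dq => a /= al <- ca; apply: contrapT => nd.
    by apply: (nb a); [rewrite in_itv in al|apply/boundaryP].
move=> a al; have : A (p + a *: v) by exists a => //=; rewrite in_itv.
by rewrite -AE => -[].
Qed.

(** Otherwise some admissible centre near p would have a boundary point of Q inside its open disk,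
    hence inside the open domain. *)
Lemma reduced_dist i s p : interior_param Q i s -> closure (dom T) p ->
  r ^+ 2 <= dot (p - curve Q i s) (p - curve Q i s).
Proof.
move=> si cp; rewrite leNgt; apply/negP => lt; set q := curve Q i s in lt.
have nq : \forall p' \near p, dot (q - p') (q - p') < r ^+ 2.
  have : dot (q - p') (q - p') @[p' --> p] --> dot (q - p) (q - p).
    by apply: lim_dot; apply: lim_subv; solve [exact: lim_id|exact: lim_cstv].
  move=> c; apply: (lim_lt c).
  by rewrite -opprB -scaleN1r dotZl dotC dotZl mulrA mulrNN !mulr1 mul1r.
have [p' [dp' /= lt']] := cp _ nq.
have qd : dom Q q.
  apply: (interior_subset dp'); rewrite /open_disk /= enorm_lt //.
have : boundary (dom Q) q.
  by rewrite (bt_boundary tableQ); exists i, s; split => //; exact: interior_closed.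
by case=> _; apply; rewrite (interior_id _).1 //; exact: bt_open.
Qed.

Lemma dot_velocity_normal x : interior_param Q x.1 (x.2 0 0) ->
  dot (velocity T x) (inner_normal T x) = cos (x.2 0 1).
Proof.
move=> xi; rewrite /velocity dotDl !dotZl (normal1 tableQ xi) mulr1.
by rewrite -scaleN1r dotZl dotC dot_rot90 !mulr0 addr0.
Qed.

Lemma velocity1 x : interior_param Q x.1 (x.2 0 0) ->
  dot (velocity T x) (velocity T x) = 1.
Proof.
move=> xi; have E (c e : R) m :
    dot (c *: m + e *: - rot90 m) (c *: m + e *: - rot90 m) =
    (c ^+ 2 + e ^+ 2) * dot m m.
  by rewrite /dot !(vec2E, mxE); ring.
by rewrite /velocity E cos2Dsin2 mul1r; exact: (normal1 tableQ xi).
Qed.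

Lemma dot_reflection v v' m : dot m m = 1 -> v = reflection m v' ->
  dot v m = - dot v' m.
Proof. by move=> m1 ->; rewrite /reflection dotBl dotZl m1; ring. Qed.

(** Of two flights of different lengths, the longer would cross the endpoint of the shorter, a
    boundary point, while still inside the open table. *)
Lemma billiard_map_position x z z' : billiard_map T x z -> billiard_map T x z' ->
  position T z = position T z'.
Proof.
move=> [_ /position_boundary/boundaryP[_ nz] [l l0 [zE dl]] _].
move=> [_ /position_boundary/boundaryP[_ nz'] [l' l'0 [z'E dl']] _].
have [ll'|l'l|ll'] := ltgtP l l'.
- by case: nz; rewrite zE; apply: dl'; rewrite l0.
- by case: nz'; rewrite z'E; apply: dl; rewrite l'0.
by rewrite zE z'E ll'.
Qed.

(* Two disks centred at the same point p of the reduced boundary could touch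
   the table in different points.  At both points the disk centred at p, and
   those centred at nearby boundary points, lie in the table, so that the two
   normals are parallel; the incoming segment excludes opposite normals. *)
Lemma billiard_map_functional x z z' : 0 < speed Q r z.1 (z.2 0 0) ->
  billiard_map T x z -> billiard_map T x z' -> z = z'.
Proof.
move=> b0 xz xz'; have pE := billiard_map_position xz xz'.
case: xz => [px pz [l l0 [zE dl]] vz]; case: xz' => [_ pz' _ vz'].
have zi : interior_param Q z.1 (z.2 0 0) by case: pz => -[].
have z'i : interior_param Q z'.1 (z'.2 0 0) by case: pz' => -[].
set N := inner_normal T z in vz; set N' := inner_normal T z' in vz'.
have N1 : dot N N = 1 by exact: (normal1 tableQ).
have N'1 : dot N' N' = 1 by exact: (normal1 tableQ).
set v := velocity T x in zE dl vz vz'.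
have qE : curve Q z'.1 (z'.2 0 0) = position T z - r *: N'.
  by rewrite pE /position /= addrK.
have vN : dot v N < 0.
  rewrite -oppr_gt0 -(dot_reflection N1 vz) dot_velocity_normal //.
  by apply: cos_gt0_pihalf; case: pz.
have vN' : dot v N' <= 0.
  rewrite leNgt; apply/negP => vN'.
  have v1 : dot v v = 1 by apply: velocity1; case: px => -[].
  have rN' : 0 < r * dot v N' by rewrite mulr_gt0.
  (* The bound l / 2 keeps the point at distance a before the impact on the incoming segment. The
     other bound makes |r N' - a v|^2 = r^2 - 2 a r (v . N') + a^2 smaller than r^2, against
     [reduced_dist]. *)
  pose a := Num.min (l / 2) (r * dot v N').
  have a0 : 0 < a by rewrite lt_min rN' divr_gt0.
  have al : a <= l / 2 by rewrite ge_min lexx.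
  have ar : a <= r * dot v N' by rewrite ge_min lexx orbT.
  have da : dom T (position T z - a *: v).
    have -> : position T z - a *: v = position T x + (l - a) *: v.
      by rewrite zE scalerBl addrA.
    by apply: dl; apply/andP; split; lra.
  have := reduced_dist z'i (subset_closure da); rewrite qE.
  have -> : position T z - a *: v - (position T z - r *: N') = r *: N' - a *: v.
    by apply: row2P; rewrite !mxE; ring.
  rewrite dotBl dotZl dotZl dotC dotBl !dotZl N'1 [dot v (_ - _)]dotC dotBl !dotZl.
  rewrite [dot N' v]dotC => H.
  rewrite v1 in H; nra.
(* Along the curve of z, the squared distance f to the touching point of z' is at least r^2, with
   equality at z: its derivative vanishes there. *)
have perp : dot N' (tangent Q z.1 (z.2 0 0)) = 0.
  have [d0 nb _] : regular_point T z.1 (z.2 0 0) by case: pz.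
  set s := z.2 0 0 in d0 nb *; set i := z.1 in d0 nb *.
  pose f t := dot (curve T i t - curve Q z'.1 (z'.2 0 0))
                  (curve T i t - curve Q z'.1 (z'.2 0 0)).
  have df t : interior_param Q i t -> is_derive t 1 f
      (2 * speed Q r i t * dot (curve T i t - curve Q z'.1 (z'.2 0 0)) (tangent Q i t)).
    move=> ti; have := is_derive_rcurve tableQ r 0 ti.
    have := is_derive_rcurve tableQ r 1 ti => D1 D0.
    rewrite (_ : f = fun t => (curve T i t 0 0 - curve Q z'.1 (z'.2 0 0) 0 0) ^+ 2
       + (curve T i t 0 1 - curve Q z'.1 (z'.2 0 0) 0 1) ^+ 2); last first.
      by apply/funext => u; rewrite /f /dot 2!mxE [in X in _ + X]mxE [in X in _ + X]mxE !mxE !expr2.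
    apply: is_derive_eq; rewrite /dot !mxE /GRing.scale /=; ring.
  have [e /= e0 ne] : \forall t \near s, interior_param Q i t /\ boundary (dom T) (curve T i t).
    by apply: filterI => //; exact: near_interior.
  have inside t : t \in `]s - e, s + e[ ->
      interior_param Q i t /\ boundary (dom T) (curve T i t).
    move=> te; apply: ne; rewrite /ball_ /= distrC ltr_distl.
    by move: te; rewrite in_itv.
  have df0 : is_derive s 1 f 0.
    apply: (@derive1_at_min _ f (s - e) (s + e)).
    - lra.
    - by move=> t /inside[ti _]; case: (df t ti).
    - by rewrite in_itv /=; apply/andP; split; lra.
    - move=> t /inside[ti /boundaryP[ct _]].
      have -> : f s = r ^+ 2.
        rewrite /f qE -/(position T z) opprB addrCA subrr addr0.
        by rewrite dotZl dotC dotZl N'1 mulr1 expr2.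
      exact: reduced_dist.
  have := @derive_val _ _ _ _ _ _ _ df0; rewrite (@derive_val _ _ _ _ _ _ _ (df s zi)).
  rewrite qE -/(position T z) opprB addrCA subrr addr0 dotZl => /eqP.
  rewrite !mulf_eq0 pnatr_eq0 /= (gt_eqF b0) (gt_eqF r0) /= => /eqP //.
have NE : N = rot90 (tangent Q z.1 (z.2 0 0)) by exact: (normalE tableQ zi).
have NN : N' = dot N' N *: N.
  apply: (@frame_eq _ _ _ (tangent Q z.1 (z.2 0 0))).
  - exact: (tangent1 tableQ zi).
  - by rewrite perp dotZl [dot N (tangent _ _ _)]dotC {2}NE dot_rot90 mulr0.
  - by rewrite dotZl -NE N1 mulr1.
(* The multiple is 1 or -1; with -1, the negative sign of v . N would make v . N' positive. *)
have c1 : dot N' N = 1.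
  have c2 : dot N' N ^+ 2 = 1.
    have : dot (dot N' N *: N) (dot N' N *: N) = 1 by rewrite -NN.
    by rewrite dotZl [dot N (_ *: _)]dotC dotZl N1 mulr1 expr2.
  move: vN'; rewrite {1}NN [dot v (_ *: _)]dotC dotZl [dot N v]dotC.
  move/eqP: c2; rewrite sqrf_eq1 => /orP[/eqP //|/eqP ->].
  by move=> H; exfalso; lra.
have N'N : N' = N by rewrite NN c1 scale1r.
have zz : z.1 = z'.1 /\ z.2 0 0 = z'.2 0 0.
  apply: (bt_simple tableQ zi); first exact: interior_closed.
  by rewrite qE N'N /position /= addrK.
have angles : z.2 0 1 = z'.2 0 1.
  have vv : velocity T z = velocity T z' by rewrite vz vz' N'N.
  have := congr1 (fun v => dot v (- rot90 N)) vv.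
  have E w : w = z \/ w = z' -> dot (velocity T w) (- rot90 N) = sin (w.2 0 1).
    move=> wz; have -> : velocity T w = cos (w.2 0 1) *: N + sin (w.2 0 1) *: - rot90 N.
      by case: wz => ->; rewrite /velocity -/N -/N' ?N'N.
    have F (c e : R) m : dot (c *: m + e *: - rot90 m) (- rot90 m) = e * dot m m.
      by rewrite /dot !(vec2E, mxE); ring.
    by rewrite F N1 mulr1.
  rewrite !E; [|by right|by left].
  have I w : phase_space T w -> w.2 0 1 \in `[- (pi / 2), pi / 2].
    by case=> _ /andP[/ltW ? /ltW ?]; rewrite in_itv; apply/andP.
  exact: sin_inj (I _ pz) (I _ pz').
case: zz => e1 e2; case: z z' e1 e2 angles {pE pz zE vz zi N N1 b0 vN pz' vz' z'i N' N'1 qE vN' perp NE NN c1 N'N} => [a u] [b w] /= -> e2 e3.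
by congr pair; apply: row2P.
Unshelve. all: by end_near. Qed.

End reduced_table.
(** It is used with w normal to a ray: a ray transversal to the curve meets it at most once near s.
    The constant d is again uniform in w. *)
Lemma rcurve_inj (R : realType) (n : nat) (Q : table R n) (r : R) (i : 'I_n)
    (s : R) (w0 : 'rV[R]_2) :
  billiard_table Q -> interior_param Q i s -> 0 < speed Q r i s ->
  0 < dot (tangent Q i s) w0 ->
  exists2 d : R, 0 < d & \forall w \near w0, forall t t',
    `|t - s| < d -> `|t' - s| < d ->
    dot (curve (reduced_table Q r) i t' - curve (reduced_table Q r) i t) w = 0 ->
    t = t'.
Proof.
move=> tQ si b0 v0; have [d [k [d0 k0 _ mono]]] := rcurve_mono tQ si b0 v0.
exists d => //; apply: near_imp mono => w mo.
suff le t t' : `|t - s| < d -> `|t' - s| < d ->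
    dot (curve (reduced_table Q r) i t' - curve (reduced_table Q r) i t) w = 0 -> t' <= t.
  move=> t t' td t'd e; apply/le_anti; rewrite (le _ _ td t'd e) andbT.
  by apply: (le _ _ t'd td); rewrite -opprB -scaleN1r dotZl e mulr0.
move=> td t'd e; rewrite leNgt; apply/negP => tt'.
have := mo _ _ td t'd (ltW tt'); rewrite e pmulr_rle0 // subr_le0.
by rewrite leNgt tt'.
Qed.

(** * The derivative of the billiard map along a common normal *)

(** What the computation of a single flight from x to y requires. Exchanging x and y gives the
    return flight, so one derivative serves both halves of the orbit. *)
Record perpendicular_chord (R : realType) (n : nat) (Q : table R n) (r : R)
    (x y : state R n) (l : R) : Prop := PerpendicularChord {
  pc_start : regular_point (reduced_table Q r) x.1 (x.2 0 0);
  pc_end : regular_point (reduced_table Q r) y.1 (y.2 0 0);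
  pc_angle_start : x.2 0 1 = 0;
  pc_angle_end : y.2 0 1 = 0;
  pc_normal : normal Q y.1 (y.2 0 0) = - normal Q x.1 (x.2 0 0);
  pc_speed_start : 0 < speed Q r x.1 (x.2 0 0);
  pc_speed_end : 0 < speed Q r y.1 (y.2 0 0);
  pc_length : 0 < l;
  pc_chord : curve (reduced_table Q r) y.1 (y.2 0 0) =
    curve (reduced_table Q r) x.1 (x.2 0 0) + l *: normal Q x.1 (x.2 0 0);
  pc_dom : forall a : R, 0 < a < l -> dom (reduced_table Q r)
    (curve (reduced_table Q r) x.1 (x.2 0 0) + a *: normal Q x.1 (x.2 0 0))
}.

Section billiard_step.
Variables (R : realType) (n : nat) (Q : table R n).
Hypothesis tableQ : billiard_table Q.
Variable r : R.
Hypothesis r0 : 0 < r.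
Local Notation T := (reduced_table Q r).
Variables (x y : state R n) (l : R).
Hypothesis xy : perpendicular_chord Q r x y l.
Let i := x.1.
Let j := y.1.
Let s0 : R := x.2 0 0.
Let t0 : R := y.2 0 0.
Let m := normal Q i s0.
Let rx : regular_point T i s0 := pc_start xy.
Let ry : regular_point T j t0 := pc_end xy.
Let ax : x.2 0 1 = 0 := pc_angle_start xy.
Let ay : y.2 0 1 = 0 := pc_angle_end xy.
Let opposite : normal Q j t0 = - m := pc_normal xy.
Let bx : 0 < speed Q r i s0 := pc_speed_start xy.
Let bY : 0 < speed Q r j t0 := pc_speed_end xy.
Let l0 : 0 < l := pc_length xy.
Let chord : curve T j t0 = curve T i s0 + l *: m := pc_chord xy.
Let chord_dom (a : R) : 0 < a < l -> dom T (curve T i s0 + a *: m).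
Proof. exact: (pc_dom xy). Qed.

Let V := 'rV[R]_2.
Implicit Types (u : V) (s t a : R).
Let pos u := curve T i (u 0 0).
Let vel u := cos (u 0 1) *: normal Q i (u 0 0) +
             sin (u 0 1) *: - rot90 (normal Q i (u 0 0)).
Let si : interior_param Q i s0. Proof. by case: rx. Qed.
Let tj : interior_param Q j t0. Proof. by case: ry. Qed.

Let m1 : dot m m = 1. Proof. exact: normal1. Qed.

Let mE : m = rot90 (tangent Q i s0). Proof. exact: normalE. Qed.

Let tangent_x : tangent Q i s0 = - rot90 m.
Proof. by rewrite mE; apply: row2P; rewrite !(mxE, vec2E) ?opprK. Qed.

Let tangent_y : tangent Q j t0 = rot90 m.
Proof.
have := opposite; rewrite (normalE tableQ tj) => E.
have /(congr1 (fun v => - rot90 v)) := E.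
have K (v : V) : - rot90 (rot90 v) = v.
  by apply: row2P; rewrite !(vec2E, mxE) ?opprK.
by rewrite K => ->; apply: row2P; rewrite !(vec2E, mxE) ?opprK.
Qed.

Let velx : vel x.2 = m.
Proof. by rewrite /vel ax cos0 sin0 scale1r scale0r addr0. Qed.

Let lim_s : (u : V) 0 0 @[u --> x.2] --> s0. Proof. exact: coord_cvg. Qed.

Let lim_pos : pos u @[u --> x.2] --> curve T i s0.
Proof.
have h : curve T i t @[t --> s0] --> curve T i s0 by exact: lim_rcurve.
exact: (lim_comp (h := curve T i) lim_s h).
Qed.

Let cdiff_normal k : cdiff (fun u : V => normal Q i (u 0 0) 0 k) x.2
  (- curvature Q i s0 * tangent Q i s0 0 k) 0.
Proof. exact: (cdiff_fst (a := x.2) (is_derive_normal tableQ k si)). Qed.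

Let cdiff_cos : cdiff (fun u : V => cos (u 0 1)) x.2 0 0.
Proof.
apply: cdiff_eq (cdiff_snd (a := x.2) (is_derive_cos _)) _ _ => //.
by rewrite ax sin0 oppr0.
Qed.

Let cdiff_sin : cdiff (fun u : V => sin (u 0 1)) x.2 0 1.
Proof.
apply: cdiff_eq (cdiff_snd (a := x.2) (is_derive_sin _)) _ _ => //.
by rewrite ax cos0.
Qed.

(** Moving the starting point turns the normal by the second Frenet equation. Changing the angle at
    0 moves the velocity along - rot90 m, which is the tangent at x, while the cosine is
    stationary. *)
Let cdiff_vel k : cdiff (fun u : V => vel u 0 k) x.2
  (- curvature Q i s0 * tangent Q i s0 0 k) (tangent Q i s0 0 k).
Proof.
have E0 : \forall u \near (x.2 : V), cos ((u : V) 0 1) * normal Q i (u 0 0) 0 0 +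
    sin (u 0 1) * normal Q i (u 0 0) 0 1 = vel u 0 0.
  by apply: near_always => u; rewrite /vel !(vec2E, mxE) opprK.
have E1 : \forall u \near (x.2 : V), cos ((u : V) 0 1) * normal Q i (u 0 0) 0 1 -
    sin (u 0 1) * normal Q i (u 0 0) 0 0 = vel u 0 1.
  by apply: near_always => u; rewrite /vel !(vec2E, mxE) mulrN.
have NE : normal Q i (x.2 0 0) = vec2 (- tangent Q i s0 0 1) (tangent Q i s0 0 0).
  exact: mE.
case: (ord2P k) => ->.
  apply: cdiff_near E0 _; apply: cdiff_eq.
  - exact: (cdiffD (cdiffM cdiff_cos (cdiff_normal 0)) (cdiffM cdiff_sin (cdiff_normal 1))).
  - by rewrite /= ax cos0 sin0 NE !vec2E; ring.
  - by rewrite /= ax cos0 sin0 NE !vec2E; ring.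
apply: cdiff_near E1 _; apply: cdiff_eq.
- exact: (cdiffB (cdiffM cdiff_cos (cdiff_normal 1)) (cdiffM cdiff_sin (cdiff_normal 0))).
- by rewrite /= ax cos0 sin0 NE !vec2E; ring.
- by rewrite /= ax cos0 sin0 NE !vec2E; ring.
Qed.

Let lim_vel : vel u @[u --> x.2] --> m.
Proof.
rewrite -velx; apply: lim_row2.
  exact: (cdiff_cvg (cdiff_vel 0)).
exact: (cdiff_cvg (cdiff_vel 1)).
Qed.

(* H u t = 0 means that the point of parameter t of curve j is on the line of the
   ray leaving the state (i, u). *)
Let H u t := dot (curve T j t - pos u) (rot90 (vel u)).

Let a_x := speed Q r i s0 - l * curvature Q i s0.

(** The displacement of the starting point contributes b_x and the turning of the normal - l k_x,
    because the target lies at distance l; turning the ray itself contributes l. *)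
Let cdiff_H : cdiff (fun u : V => H u t0) x.2 a_x l.
Proof.
have cpos k : cdiff (fun u : V => pos u 0 k) x.2 (speed Q r i s0 * tangent Q i s0 0 k) 0.
  exact: (cdiff_fst (a := x.2) (is_derive_rcurve tableQ r k si)).
have HE : \forall u \near x.2, (curve T j t0 0 1 - pos u 0 1) * vel u 0 0 -
    (curve T j t0 0 0 - pos u 0 0) * vel u 0 1 = H u t0.
  by apply: near_always => u; rewrite /H /dot !(vec2E, mxE); ring.
apply: cdiff_near HE _; apply: cdiff_eq.
- exact: (cdiffB (cdiffM (cdiffB (cdiff_cst _ _) (cpos 1)) (cdiff_vel 0))
                 (cdiffM (cdiffB (cdiff_cst _ _) (cpos 0)) (cdiff_vel 1))).
- cbv beta; rewrite velx chord /pos -/s0 mE !(vec2E, mxE).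
  rewrite /a_x -[RHS]mulr1 -(tangent1 tableQ si) /dot; ring.
- cbv beta; rewrite velx chord /pos -/s0 mE !(vec2E, mxE).
  rewrite -[RHS]mulr1 -(tangent1 tableQ si) /dot; ring.
Qed.

Let H0 : H x.2 t0 = 0.
Proof.
by rewrite /H velx /pos -/s0 chord addrAC subrr add0r dotZl dot_rot90 mulr0.
Qed.

(** For every u near the orbit, [H u] increases with slope at least k on a fixed window around t0.
    The intermediate value theorem gives a zero arbitrarily close to t0, and monotonicity makes it
    unique in the window. *)
Lemma exists_hit : exists tau : V -> R, [/\ tau x.2 = t0,
  tau u @[u --> x.2] --> t0 & \forall u \near x.2, H u (tau u) = 0].
Proof.
have ty : 0 < dot (tangent Q j t0) (rot90 m) by rewrite tangent_y dot_rot90_rot90 m1.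
have [d [k [d0 k0 inter mono]]] := rcurve_mono tableQ tj bY ty.
have monoH : \forall u \near x.2, forall t t', `|t - t0| < d -> `|t' - t0| < d ->
    t <= t' -> k * (t' - t) <= H u t' - H u t.
  have := lim_rot90 lim_vel mono; apply: near_imp => u Pu t t' td t'd tt'.
  apply: le_trans (Pu _ _ td t'd tt') _.
  by rewrite /H !dotBl opprB addrA subrK.
have limH t : H u t @[u --> x.2] --> H x.2 t.
  apply: lim_dot; last by rewrite velx; exact: lim_rot90 lim_vel.
  by apply: lim_subv; [exact: lim_cstv|exact: lim_pos].
have dx := nbhs_singleton monoH.
have exH e : 0 < e -> e < d ->
    \forall u \near x.2, exists2 t, `|t - t0| <= e & H u t = 0.
  move=> e0 ed.
  have ke : 0 < k * e by rewrite mulr_gt0.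
  have t0d : `|t0 - t0| < d by rewrite subrr normr0.
  have t0ed : `|t0 + e - t0| < d by rewrite addrAC subrr add0r gtr0_norm.
  have t0ed' : `|t0 - e - t0| < d by rewrite addrAC subrr add0r normrN gtr0_norm.
  (* At the orbit the slope bound makes H at least k e at t0 + e; continuity in u at this fixed
     parameter preserves the sign. *)
  have up : \forall u \near x.2, 0 < H u (t0 + e).
    apply: lim_gt (limH _) _; have := dx _ _ t0d t0ed; rewrite H0 subr0 lerDl.
    by move=> /(_ (ltW e0)); lra.
  have dn : \forall u \near x.2, H u (t0 - e) < 0.
    apply: lim_lt (limH _) _; have := dx _ _ t0ed' t0d; rewrite H0 sub0r gerBl.
    by move=> /(_ (ltW e0)); lra.
  near=> u; have Hu : 0 < H u (t0 + e) by near: u.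
  have Hd : H u (t0 - e) < 0 by near: u.
  have cH : {within `[t0 - e, t0 + e], continuous (H u)}.
    apply: derivable_within_continuous => t; rewrite in_itv /= => /andP[te et].
    have ti : interior_param Q j t.
      by apply: inter; rewrite ltr_norml; apply/andP; split; lra.
    have D0 := is_derive_rcurve tableQ r 0 ti; have D1 := is_derive_rcurve tableQ r 1 ti.
    rewrite (_ : H u = fun t => (curve T j t 0 0 - pos u 0 0) * rot90 (vel u) 0 0
       + (curve T j t 0 1 - pos u 0 1) * rot90 (vel u) 0 1); last first.
      apply/funext => t'; rewrite /H /dot [(curve T j t' - pos u) 0 0]mxE.
      by rewrite [(curve T j t' - pos u) 0 1]mxE [(- pos u) 0 0]mxE [(- pos u) 0 1]mxE.
    by [].
  have [|||t tI Ht] := @IVT _ (H u) (t0 - e) (t0 + e) 0 => //; first lra.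
    by rewrite ge_min le_max (ltW Hd) (ltW Hu) orbT.
  exists t => //; move: tI; rewrite in_itv /= => /andP[? ?].
  by rewrite ler_norml; apply/andP; split; lra.
have uniq u : (forall t t', `|t - t0| < d -> `|t' - t0| < d ->
    t <= t' -> k * (t' - t) <= H u t' - H u t) ->
    forall t t', `|t - t0| < d -> `|t' - t0| < d -> H u t = 0 -> H u t' = 0 -> t = t'.
  move=> mo; suff le t t' : `|t - t0| < d -> `|t' - t0| < d -> H u t = 0 ->
      H u t' = 0 -> t <= t'.
    by move=> t t' td t'd Ht Ht'; apply/le_anti; rewrite !le.
  move=> td t'd Ht Ht'; rewrite leNgt; apply/negP => t't.
  have := mo _ _ t'd td (ltW t't); rewrite Ht Ht' subrr pmulr_rle0 // subr_le0.
  by rewrite leNgt t't.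
(* The default value t0 is returned only when the window contains no zero, which does not happen
   near the orbit. *)
pose tau u := xget t0 [set t | `|t - t0| < d /\ H u t = 0].
have tauP u : (exists2 t, `|t - t0| < d & H u t = 0) ->
    `|tau u - t0| < d /\ H u (tau u) = 0.
  move=> [t td Ht].
  exact: (@xgetPex _ t0 [set t | `|t - t0| < d /\ H u t = 0] (ex_intro _ t (conj td Ht))).
have taux : tau x.2 = t0.
  have t0d : `|t0 - t0| < d by rewrite subrr normr0.
  have [|td Ht] := tauP x.2; first by exists t0.
  exact: (uniq _ dx _ _ td t0d Ht H0).
exists tau; split => //.
  (* With e' < d, the zero found within e' of t0 lies in the window, so it is the chosen one. *)
  apply: lim_dist => e e0; pose e' := Num.min e (d / 2).
  have e'0 : 0 < e' by rewrite lt_min e0 divr_gt0.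
  have e'd : e' < d by rewrite gt_min [X in _ || X](_ : _ = true) ?orbT //; lra.
  have ee' : e' <= e by rewrite ge_min lexx.
  have n1 := exH _ e'0 e'd.
  near=> u; have [t te Ht] : exists2 t, `|t - t0| <= e' & H u t = 0 by near: u.
  have td : `|t - t0| < d by exact: le_lt_trans e'd.
  have [taud Htau] : `|tau u - t0| < d /\ H u (tau u) = 0 by apply: tauP; exists t.
  have -> : tau u = t.
    by apply: (uniq u) => //; near: u.
  exact: le_trans ee'.
have d2 : 0 < d / 2 by rewrite divr_gt0.
have dd : d / 2 < d by lra.
apply: near_imp (exH _ d2 dd) => u [t td Ht].
by have [] : `|tau u - t0| < d /\ H u (tau u) = 0
  by apply: tauP; exists t => //; exact: le_lt_trans dd.
Unshelve. all: by end_near. Qed.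

(** * The next reflection as a function of the state *)

Section hitting_parameter.
Variable tau : V -> R.
Hypotheses (taux : tau x.2 = t0) (lim_tau : tau u @[u --> x.2] --> t0).
Hypothesis Htau : \forall u \near x.2, H u (tau u) = 0.

Let b_y := speed Q r j t0.

(* H u (tau u) = 0 reads tau u = t0 - H u t0 / b u, where b u, the slope of H u
   between t0 and tau u, is only known to be continuous at the orbit. *)
Lemma cdiff_tau : cdiff tau x.2 (- (a_x / b_y)) (- (l / b_y)).
Proof.
have /is_derive1_caratheodory[p0 [p0E p0c p0b]] := is_derive_rcurve tableQ r 0 tj.
have /is_derive1_caratheodory[p1 [p1E p1c p1b]] := is_derive_rcurve tableQ r 1 tj.
pose b u := dot (vec2 (p0 (tau u)) (p1 (tau u))) (rot90 (vel u)).
have lim_b : b u @[u --> x.2] --> b_y.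
  have -> : b_y = dot (vec2 (p0 t0) (p1 t0)) (rot90 m).
    rewrite p0b p1b -[LHS]mulr1 -m1 -dot_rot90_rot90 -tangent_y.
    by rewrite /dot !vec2E -/b_y; ring.
  apply: lim_dot; last exact: lim_rot90 lim_vel.
  by apply: lim_vec2; [exact: (lim_comp lim_tau p0c)|exact: (lim_comp lim_tau p1c)].
have bn : \forall u \near x.2, 0 < b u by exact: lim_gt lim_b _.
have lim_bV : - (b u)^-1 @[u --> x.2] --> - b_y^-1.
  have iv : z^-1 @[z --> b_y] --> b_y^-1 by apply: inv_continuous; rewrite gt_eqF.
  have h := lim_comp (h := fun z : R => z^-1) lim_b iv.
  exact: limN h.
have d1 := cdiffM_cvg cdiff_H H0 lim_bV.
have n1 : \forall u \near x.2, t0 + H u t0 * - (b u)^-1 = tau u.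
  near=> u; have b0 : 0 < b u by near: u.
  have : H u (tau u) = 0 by near: u.
  have -> : H u (tau u) = H u t0 + b u * (tau u - t0).
    rewrite /H /b /dot !vec2E.
    have E k (v : V) t : (curve T j t - v) 0 k = curve T j t 0 k - v 0 k.
      by rewrite [LHS]mxE [(- v) 0 k]mxE.
    rewrite !E -[curve T j (tau u) 0 0](subrK (curve T j t0 0 0)) p0E.
    by rewrite -[curve T j (tau u) 0 1](subrK (curve T j t0 0 1)) p1E; ring.
  move=> E; have -> : H u t0 = - (b u * (tau u - t0)) by apply/eqP; rewrite -addr_eq0 E.
  by field; rewrite gt_eqF.
apply: cdiff_near n1 _; apply: cdiff_eq (cdiffD (cdiff_cst t0 _) d1) _ _;
  by rewrite add0r mulrN.
Unshelve. all: by end_near. Qed.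

(** Reflection preserves the tangential component of the velocity, and this component is the sine of
    the outgoing angle. *)
Let angle u := asin (dot (vel u) (tangent Q j (tau u))).

Let dot_x : dot (vel x.2) (tangent Q j (tau x.2)) = 0.
Proof. by rewrite velx taux tangent_y dot_rot90. Qed.

Lemma cdiff_angle : cdiff angle x.2
  (curvature Q i s0 + curvature Q j t0 * (a_x / b_y))
  (-1 + curvature Q j t0 * (l / b_y)).
Proof.
have dt k : cdiff (fun u => tangent Q j (tau u) 0 k) x.2
    (curvature Q j t0 * normal Q j t0 0 k * - (a_x / b_y))
    (curvature Q j t0 * normal Q j t0 0 k * - (l / b_y)).
  apply: (cdiff_comp1 (h := fun t => tangent Q j t 0 k) cdiff_tau).
  by rewrite taux; exact: is_derive_tangent.
have dd : cdiff (fun u => dot (vel u) (tangent Q j (tau u))) x.2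
    (curvature Q i s0 + curvature Q j t0 * (a_x / b_y))
    (-1 + curvature Q j t0 * (l / b_y)).
  apply: cdiff_eq.
  - exact: (cdiffD (cdiffM (cdiff_vel 0) (dt 0)) (cdiffM (cdiff_vel 1) (dt 1))).
  - cbv beta; rewrite velx taux tangent_y opposite tangent_x.
    transitivity (dot m m * (curvature Q i s0 + curvature Q j t0 * (a_x / b_y))).
      by rewrite /dot !(vec2E, mxE); ring.
    by rewrite m1 mul1r.
  - cbv beta; rewrite velx taux tangent_y opposite tangent_x.
    transitivity (dot m m * (-1 + curvature Q j t0 * (l / b_y))).
      by rewrite /dot !(vec2E, mxE); ring.
    by rewrite m1 mul1r.
have d1 : is_derive (dot (vel x.2) (tangent Q j (tau x.2))) 1 (@asin R) 1.
  have i0 : -1 < (0 : R) < 1 by rewrite ltrN10 ltr01.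
  have := is_derive1_asin i0.
  by rewrite dot_x expr0n /= subr0 sqrtr1 invr1.
by apply: cdiff_eq (cdiff_comp1 dd d1) _ _; rewrite mul1r.
Qed.

Let hit u := dot (curve T j (tau u) - pos u) (vel u).

Let lim_coord1 : (u : V) 0 1 @[u --> x.2] --> 0.
Proof. by rewrite -ax; exact: coord_cvg. Qed.

Let lim_tangent_tau : tangent Q j (tau u) @[u --> x.2] --> rot90 m.
Proof.
rewrite -tangent_y; have h := lim_tangent tableQ tj.
exact: (lim_comp (h := tangent Q j) lim_tau h).
Qed.

Let lim_normal_tau : normal Q j (tau u) @[u --> x.2] --> - m.
Proof.
rewrite -opposite; have h := lim_normal tableQ tj.
exact: (lim_comp (h := normal Q j) lim_tau h).
Qed.

Let lim_curve_tau : curve T j (tau u) @[u --> x.2] --> curve T j t0.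
Proof.
have h : curve T j t @[t --> t0] --> curve T j t0 by exact: lim_rcurve.
exact: (lim_comp (h := curve T j) lim_tau h).
Qed.

Let lim_hit : hit u @[u --> x.2] --> l.
Proof.
have -> : l = dot (curve T j t0 - curve T i s0) m.
  by rewrite chord addrAC subrr add0r dotZl m1 mulr1.
by apply: lim_dot; [apply: lim_subv; [exact: lim_curve_tau|exact: lim_pos]|exact: lim_vel].
Qed.

Let near_i : \forall u \near x.2, interior_param Q i ((u : V) 0 0).
Proof. exact: (lim_s (near_interior si)). Qed.

Let vel1 u : interior_param Q i (u 0 0) -> dot (vel u) (vel u) = 1.
Proof. exact: (velocity1 tableQ r (x := (i, u))). Qed.

Let near_hit : \forall u \near x.2, curve T j (tau u) = pos u + hit u *: vel u.
Proof.
near=> u; have v1 : dot (vel u) (vel u) = 1 by apply: vel1; near: u.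
have Hu : H u (tau u) = 0 by near: u.
have -> : hit u *: vel u = curve T j (tau u) - pos u.
  apply: (frame_eq v1); first by rewrite dotZl v1 mulr1.
  by rewrite dotZl dot_rot90 mulr0; exact/esym/Hu.
by rewrite addrC subrK.
Unshelve. all: by end_near. Qed.

(* The middle of the segment stays in the open table by compactness; near its
   ends the boundary is a single curve, transversal to the ray, which therefore
   meets it only in the endpoint. *)
Let near_segment : \forall u \near x.2, forall a, 0 < a < hit u ->
  dom T (pos u + a *: vel u).
Proof.
pose P u a := 0 < a -> a < hit u -> ~ boundary (dom T) (pos u + a *: vel u).
have tx : 0 < dot (tangent Q i s0) (- rot90 m).
  by rewrite -tangent_x (tangent1 tableQ).
have ty : 0 < dot (tangent Q j t0) (rot90 m) by rewrite tangent_y dot_rot90_rot90 m1.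
have [d1 d10 inj1] := rcurve_inj tableQ si bx tx.
have [d2 d20 inj2] := rcurve_inj tableQ tj bY ty.
have lim1 : - rot90 (vel u) @[u --> x.2] --> - rot90 m.
  exact: lim_oppv (lim_rot90 lim_vel).
have {}inj1 := lim1 _ inj1.
have {}inj2 := lim_rot90 lim_vel inj2.
(* Near the orbit all flights are shorter than l + 1, so a compact interval independent of u covers
   them. *)
have cov : \forall u \near x.2, `[0, l + 1]%classic `<=` P u.
  have /compact_near_coveringP nc := @segment_compact R 0 (l + 1).
  apply: (nc V (nbhs x.2) P); move=> a0 /=; rewrite in_itv /= => /andP[a00 a0l].
  change (\forall z \near (a0, x.2 : V), P z.2 z.1).
  set z0 := (a0, x.2 : V).
  have l1 : z.1 @[z --> z0] --> a0 by exact: cvg_fst.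
  have l2 : z.2 @[z --> z0] --> (x.2 : V) by exact: cvg_snd.
  have lp : pos z.2 @[z --> z0] --> curve T i s0 by exact: (lim_comp l2 lim_pos).
  have lv : vel z.2 @[z --> z0] --> m by exact: (lim_comp l2 lim_vel).
  have lh : hit z.2 @[z --> z0] --> l by exact: (lim_comp l2 lim_hit).
  have lphi : pos z.2 + z.1 *: vel z.2 @[z --> z0] --> curve T i s0 + a0 *: m.
    by apply: lim_addv lp _; exact: lim_scalev.
  have ni : \forall z \near z0, interior_param Q i ((z : R * V).2 0 0) by exact: (l2 _ near_i).
  have [la|al|lE] := ltgtP l a0.
  (* Beyond l the parameter exceeds the flight length nearby, and [P] holds vacuously. *)
  - have lt1 : \forall z \near z0, hit z.2 < (l + a0) / 2 by apply: lim_lt lh _; lra.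
    have lt2 : \forall z \near z0, (l + a0) / 2 < z.1 by apply: lim_gt l1 _; lra.
    near=> z => _ zh; have h1 : hit z.2 < (l + a0) / 2 by near: z.
    have h2 : (l + a0) / 2 < z.1 by near: z.
    by exfalso; lra.
  - move: a00; rewrite le_eqVlt => /predU1P[aE|a00].
      have phi0 : curve T i s0 + a0 *: m = curve T i s0 by rewrite -aE scale0r addr0.
      have [_ _ /(_ _ d10)] := rx; rewrite -phi0 => rb.
      have {}rb := lphi _ rb.
      have nd : \forall z \near z0, `|(z : R * V).2 0 0 - s0| < d1.
        exact: (l2 _ (near_dist lim_s d10)).
      have {}inj1 := l2 _ inj1.
      near=> z => z0' zh bz.
      have [t ts tE] : exists2 t, `|t - s0| < d1 & pos z.2 + z.1 *: vel z.2 = curve T i t.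
        by move: bz; near: z.
      have zi : interior_param Q i (z.2 0 0) by near: z.
      have zd : `|(z.2 : V) 0 0 - s0| < d1 by near: z.
      have E : z.1 *: vel z.2 = curve T i t - curve T i (z.2 0 0).
        by rewrite -tE addrAC subrr add0r.
      have tt : z.2 0 0 = t.
        have : dot (curve T i t - curve T i (z.2 0 0)) (- rot90 (vel z.2)) = 0.
          by rewrite -E dotZl dotC -scaleN1r dotZl dotC dot_rot90 !mulr0.
        (* Generalizing both parameters leaves a statement about z alone, which holds near the orbit
           by [inj1]. *)
        move: ts zd => + +; move: (z.2 0 0) t {tE E zi}.
        by near: z; apply: near_imp inj1 => z inj a b ad bd; exact: inj.
      have : z.1 * dot (vel z.2) (vel z.2) = 0.
        by rewrite -dotZl E tt subrr /dot !mxE !mul0r addr0.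
      by rewrite (vel1 zi); lra.
    have dn : \forall p \near curve T i s0 + a0 *: m, dom T p.
      by apply: open_nbhs_nbhs; split; [exact: open_dom|apply: chord_dom; rewrite a00].
    apply: near_imp (lphi _ dn) => z dz _ _ /boundaryP[]; exact.
  - have phil : curve T i s0 + a0 *: m = curve T j t0 by rewrite -lE chord.
    have [_ _ /(_ _ d20)] := ry; rewrite -phil => rb.
    have {}rb := lphi _ rb.
    have nd : \forall z \near z0, `|tau z.2 - t0| < d2.
      exact: (l2 _ (near_dist lim_tau d20)).
    have {}inj2 := l2 _ inj2.
    have nh := l2 _ near_hit.
    near=> z => z0' zh bz.
    have [t ts tE] : exists2 t, `|t - t0| < d2 & pos z.2 + z.1 *: vel z.2 = curve T j t.
      by move: bz; near: z.
    have zi : interior_param Q i (z.2 0 0) by near: z.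
    have zd : `|tau z.2 - t0| < d2 by near: z.
    have hE : curve T j (tau z.2) = pos z.2 + hit z.2 *: vel z.2 by near: z.
    have E : (hit z.2 - z.1) *: vel z.2 = curve T j (tau z.2) - curve T j t.
      by rewrite -tE hE scalerBl opprD addrACA subrr add0r.
    have tt : t = tau z.2.
      have : dot (curve T j (tau z.2) - curve T j t) (rot90 (vel z.2)) = 0.
        by rewrite -E dotZl dot_rot90 mulr0.
      move: ts zd => + +; move: t (tau z.2) {tE E hE zi}.
      by near: z; apply: near_imp inj2 => z inj a b ad bd; exact: inj.
    have : (hit z.2 - z.1) * dot (vel z.2) (vel z.2) = 0.
      by rewrite -dotZl E tt subrr /dot !mxE !mul0r addr0.
    by rewrite (vel1 zi); lra.
have h1 : \forall u \near x.2, hit u < l + 1.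
  by apply: lim_lt lim_hit _; rewrite ltrDl.
have h2 : \forall u \near x.2, l / 2 < hit u.
  by apply: lim_gt lim_hit _; have := l0; lra.
(* Points near the midpoint of the chord lie in the open table; they give [segment_in_dom] its
   interior point. *)
have dn : \forall u \near x.2, dom T (pos u + (l / 2) *: vel u).
  have lphi : pos u + (l / 2) *: vel u @[u --> x.2] --> curve T i s0 + (l / 2) *: m.
    by apply: lim_addv lim_pos _; apply: lim_scalev lim_vel; exact: lim_cst.
  apply: lphi; apply: open_nbhs_nbhs; split; first exact: open_dom.
  by apply: chord_dom; have := l0; lra.
near=> u; apply: segment_in_dom.
  move=> a /andP[a0 ah].
  have hu : hit u < l + 1 by near: u.
  have Pu : `[0, l + 1]%classic `<=` P u by near: u.
  by apply: Pu => //=; rewrite in_itv /=; rewrite (ltW a0) (ltW (lt_trans ah hu)).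
have hu : l / 2 < hit u by near: u.
exists (l / 2); first by rewrite hu divr_gt0.
by near: u.
Unshelve. all: by end_near. Qed.

(** Regularity, the bounds on the angles and the positive flight length are open conditions that
    hold at the orbit, so the candidate is an image for every nearby state. That it is the only one
    is [billiard_map_functional]. *)
Lemma near_billiard_map : \forall u \near x.2, forall z,
  billiard_map T (i, u) z <-> z = (j, vec2 (tau u) (angle u)).
Proof.
have pi2 : 0 < pi / 2 :> R by rewrite divr_gt0 // pi_gt0.
have n1 : \forall u \near x.2, regular_point T i ((u : V) 0 0).
  exact: (lim_s (regular_point_near tableQ rx bx)).
have n2 : \forall u \near x.2, regular_point T j (tau u).
  exact: (lim_tau (regular_point_near tableQ ry bY)).
have n3 : \forall u \near x.2, 0 < speed Q r j (tau u).
  have : \forall t \near t0, 0 < speed Q r j t.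
    by apply: (lim_gt _ bY); exact: lim_speed.
  by move=> h; exact: (lim_tau h).
have n4 : \forall u \near x.2, `|(u : V) 0 1 - 0| < pi / 2.
  exact: near_dist lim_coord1 pi2.
have n5 : \forall u \near x.2, `|dot (vel u) (tangent Q j (tau u)) - 0| < 1.
  apply: near_dist ltr01; rewrite -(dot_rot90 m).
  exact: lim_dot lim_vel lim_tangent_tau.
have n6 : \forall u \near x.2, dot (vel u) (normal Q j (tau u)) < 0.
  apply: lim_lt (lim_dot lim_vel lim_normal_tau) _.
  by rewrite dotC -scaleN1r dotZl m1 mulr1 ltrN10.
have n7 : \forall u \near x.2, 0 < hit u by exact: lim_gt lim_hit l0.
near=> u => z.
have ui : regular_point T i (u 0 0) by near: u.
have uj : regular_point T j (tau u) by near: u.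
have bu : 0 < speed Q r j (tau u) by near: u.
have uint : interior_param Q i (u 0 0) by case: ui.
have tint : interior_param Q j (tau u) by case: uj.
have v1 := vel1 uint.
have a1 : `|dot (vel u) (tangent Q j (tau u)) - 0| < 1 by near: u.
have vN : dot (vel u) (normal Q j (tau u)) < 0 by near: u.
rewrite subr0 ltr_norml in a1.
set t := tangent Q j (tau u) in a1 *; set N := normal Q j (tau u) in vN *.
have t1 : dot t t = 1 by exact: (tangent1 tableQ).
have NE : N = rot90 t by exact: (normalE tableQ).
have N1 : dot N N = 1 by exact: (normal1 tableQ).
(* As v is a unit vector, 1 - (v . t)^2 = (v . N)^2 in the frame t, N; the sign of the root comes
   from v . N < 0. *)
have cosE : cos (angle u) = - dot (vel u) N.
  rewrite cos_asin; last by case/andP: a1 => /ltW -> /ltW ->.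
  rewrite -[RHS]ger0_norm; last by rewrite oppr_ge0 ltW.
  rewrite -sqrtr_sqr sqrrN; congr Num.sqrt.
  rewrite -[1]v1 NE; move: t1; rewrite /dot !vec2E.
  set a := vel u 0 0; set b := vel u 0 1; set c := t 0 0; set e := t 0 1 => ce.
  have -> : a * a + b * b = (a * a + b * b) * (c * c + e * e) by rewrite ce mulr1.
  by ring.
have sinE : sin (angle u) = dot (vel u) t.
  by rewrite asinK // in_itv /=; case/andP: a1 => /ltW -> /ltW ->.
have step : billiard_map T (i, u) (j, vec2 (tau u) (angle u)).
  split.
  - split => //=; have : `|u 0 1 - 0| < pi / 2 by near: u.
    by rewrite subr0 ltr_norml.
  - split; rewrite /= ?vec2E //; case/andP: a1 => a1 a2.
    by rewrite asin_gtNpi2 ?asin_ltpi2 // ?a1 ?a2 ?(ltW a1) ?(ltW a2).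
  - exists (hit u); first by near: u.
    split; first by rewrite /position [(_, _).2]/= vec2E; near: u.
    by near: u.
  - rewrite -[velocity T (i, u)]/(vel u) /velocity /inner_normal /= !vec2E -/N.
    apply: (frame_eq t1).
      rewrite dotDl !dotZl sinE NE [dot (rot90 t) t]dotC dot_rot90 mulr0 add0r.
      rewrite /reflection dotBl dotZl [dot (rot90 t) t]dotC dot_rot90 mulr0 subr0.
      rewrite (_ : - rot90 (rot90 t) = t) ?t1 ?mulr1 //.
      by apply: row2P; rewrite !(vec2E, mxE) ?opprK.
    rewrite -NE dotDl !dotZl N1 mulr1 -[- rot90 N]scaleN1r dotZl [dot (rot90 N) N]dotC.
    rewrite dot_rot90 !mulr0 addr0 cosE /reflection dotBl dotZl N1; ring.
split=> [stepz|->] //.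
by apply/esym/(billiard_map_functional tableQ r0 _ step stepz); rewrite /= vec2E.
Unshelve. all: by end_near. Qed.

Lemma angle_start : angle x.2 = 0.
Proof. by rewrite /angle dot_x -[X in asin X]sin0 sinK // in_itv /= oppr_le0 !divr_ge0 ?pi_ge0. Qed.

End hitting_parameter.

Lemma billiard_step : exists f g : V -> R,
  [/\ vec2 (f x.2) (g x.2) = y.2,
      cdiff f x.2 (- (a_x / speed Q r j t0)) (- (l / speed Q r j t0)),
      cdiff g x.2
        (curvature Q i s0 + curvature Q j t0 * (a_x / speed Q r j t0))
        (-1 + curvature Q j t0 * (l / speed Q r j t0)) &
      \forall u \near x.2, forall z,
        billiard_map T (i, u) z <-> z = (j, vec2 (f u) (g u))].
Proof.
have [tau [taux lim_tau Htau]] := exists_hit.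
exists tau, (fun u => asin (dot (vel u) (tangent Q j (tau u)))); split.
- apply: row2P; rewrite vec2E; first exact: taux.
  by rewrite [RHS]ay; exact: angle_start.
- exact: cdiff_tau.
- exact: cdiff_angle.
- exact: near_billiard_map.
Qed.

End billiard_step.
(** * Period-two orbits *)

Section second_iterate.
Variables (R : realType) (n : nat) (Q : table R n).
Hypothesis tableQ : billiard_table Q.
Variable r : R.
Hypothesis r0 : 0 < r.
Local Notation T := (reduced_table Q r).
Implicit Types x y : state R n.

(** The matrix of the flight from x to y has determinant b_x / b_y and that of the return flight b_y
    / b_x, whence determinant 1 for the composite. *)
Lemma derivative2_chord x y l :
  perpendicular_chord Q r x y l -> perpendicular_chord Q r y x l ->
  exists A, [/\ derivative2 T x A, \det A = 1 &
    \tr A = 4 * (speed Q r x.1 (x.2 0 0) - l * curvature Q x.1 (x.2 0 0)) *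
                (speed Q r y.1 (y.2 0 0) - l * curvature Q y.1 (y.2 0 0)) /
            (speed Q r x.1 (x.2 0 0) * speed Q r y.1 (y.2 0 0)) - 2].
Proof.
move=> xy yx; have bx := pc_speed_start xy; have bY := pc_speed_end xy.
have [f1 [g1 [e1 df1 dg1 n1]]] := billiard_step tableQ r0 xy.
have [f2 [g2 [e2 df2 dg2 n2]]] := billiard_step tableQ r0 yx.
(* The return flight is differentiated at y.2; writing y.2 as the image of x.2 gives the form that
   the chain rule expects. *)
rewrite -[X in cdiff _ X _ _]e1 in df2.
rewrite -[X in cdiff _ X _ _]e1 in dg2.
have dF := cdiff_comp2 df1 dg1 df2; have dG := cdiff_comp2 df1 dg1 dg2.
have [difG jacG] := cdiff_differentiable dF dG.
eexists; split.
- eexists; split; [|exact: difG|exact: jacG].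
  have lim1 : vec2 (f1 u) (g1 u) @[u --> x.2] --> y.2.
    by rewrite -e1; apply: lim_vec2; [exact: cdiff_cvg df1|exact: cdiff_cvg dg1].
  have {}n2 := lim1 _ n2.
  near=> u => w.
  have h1 : forall z, billiard_map T (x.1, u) z <-> z = (y.1, vec2 (f1 u) (g1 u)).
    by near: u.
  have h2 : forall w, billiard_map T (y.1, vec2 (f1 u) (g1 u)) w <->
        w = (x.1, vec2 (f2 (vec2 (f1 u) (g1 u))) (g2 (vec2 (f1 u) (g1 u)))).
    by near: u.
  split=> [[z /h1 -> /h2] //|->].
  by exists (y.1, vec2 (f1 u) (g1 u)); [apply/h1|apply/h2].
- rewrite det_mx2 !mxE /=; field.
  by rewrite !gt_eqF.
- rewrite mxtrace2 !mxE /=; field.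
  by rewrite !gt_eqF.
Unshelve. all: by end_near. Qed.

End second_iterate.

(** * From a period-two orbit to a perpendicular chord *)

Section period_two.
Variables (R : realType) (n : nat) (Q : table R n).
Hypothesis tableQ : billiard_table Q.
Variable r : R.
Local Notation T := (reduced_table Q r).
Implicit Types x y : state R n.

(** On a period-two orbit the incoming velocity is the opposite of the outgoing one. Reflecting - v
    to v gives v = (v . N) N, and a unit vector with positive normal component is then N itself. *)
Lemma normal_velocity x : phase_space T x ->
  velocity T x = reflection (inner_normal T x) (- velocity T x) ->
  x.2 0 1 = 0 /\ velocity T x = inner_normal T x.
Proof.
move=> [[xi _ _] xa] E.
have cosx : 0 < cos (x.2 0 1) by exact: cos_gt0_pihalf.
have vE : velocity T x = cos (x.2 0 1) *: inner_normal T x.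
  rewrite -(dot_velocity_normal tableQ r xi).
  move: E; rewrite /reflection -scaleN1r dotZl; set v := velocity T x.
  set d := dot v _; set N := inner_normal T x => E.
  have : 2 *: v = (2 * d) *: N.
    by rewrite scaler_nat mulr2n {1}E scaleN1r addrAC addNr add0r mulN1r mulrN scaleNr opprK.
  move/(congr1 (fun u => 2^-1 *: u)); rewrite !scalerA mulrA mulVf ?pnatr_eq0 //.
  by rewrite mul1r scale1r.
have c1 : cos (x.2 0 1) = 1.
  have : cos (x.2 0 1) ^+ 2 = 1.
    have := velocity1 tableQ r xi; rewrite {1}vE dotZl dotC.
    by rewrite (dot_velocity_normal tableQ r xi) expr2.
  by move/eqP; rewrite sqrf_eq1 => /orP[/eqP //|/eqP c]; lra.
split; last by rewrite vE c1 scale1r.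
have pi0 := pi_ge0 R.
have s0 : sin (x.2 0 1) = sin 0.
  apply/eqP; rewrite sin0 -sqrf_eq0 sin2cos2 c1; apply/eqP; ring.
apply: sin_inj s0; rewrite in_itv /=; apply/andP; split; lra.
Qed.

(** The two displacements cancel; as both velocities are unit vectors and both lengths are positive,
    the lengths agree. *)
Lemma opposite_velocities x y l l' : phase_space T x -> phase_space T y ->
  0 < l -> 0 < l' ->
  position T y = position T x + l *: velocity T x ->
  position T x = position T y + l' *: velocity T y ->
  velocity T y = - velocity T x.
Proof.
move=> [[xi _ _] _] [[yi _ _] _] l0 l'0 yE xE.
have E : l *: velocity T x = - (l' *: velocity T y).
  by apply/eqP; rewrite -addr_eq0; apply/eqP/(addrI (position T x)); rewrite addrA -yE -xE addr0.
have ll' : l = l'.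
  have : dot (l *: velocity T x) (l *: velocity T x) = l ^+ 2.
    by rewrite dotZl dotC dotZl (velocity1 tableQ r xi) mulr1 expr2.
  rewrite E -scaleN1r scalerA mulN1r dotZl dotC dotZl (velocity1 tableQ r yi) mulr1.
  rewrite mulrNN -expr2 => /eqP; rewrite eqrXn2 ?ltW // => /eqP //.
apply: (scalerI (lt0r_neq0 l0)); rewrite scalerN E ll' opprK //.
Qed.

Hypothesis r0 : 0 < r.

(** The normals at the two ends are opposite and lie along the chord, so passing from the reduced
    table back to Q lengthens it by r at each end. *)
Lemma period_two_chord x y : period_two_orbit T x y ->
  0 < speed Q r x.1 (x.2 0 0) -> 0 < speed Q r y.1 (y.2 0 0) ->
  exists l, [/\ perpendicular_chord Q r x y l, perpendicular_chord Q r y x l &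
    enorm (position Q y - position Q x) = l + 2 * r].
Proof.
move=> [[px py [l l0 [yE dl]] vy] [_ _ [l' l'0 [xE dl']] vx]] bx bY.
have opp := opposite_velocities px py l0 l'0 yE xE.
have [ay vyN] : y.2 0 1 = 0 /\ velocity T y = inner_normal T y.
  by apply: normal_velocity => //; rewrite {1}vy opp opprK.
have [ax vxN] : x.2 0 1 = 0 /\ velocity T x = inner_normal T x.
  by apply: normal_velocity => //; rewrite {1}vx opp.
have NN : normal Q y.1 (y.2 0 0) = - normal Q x.1 (x.2 0 0).
  by rewrite -[LHS]/(inner_normal T y) -vyN opp vxN.
have NN' : normal Q x.1 (x.2 0 0) = - normal Q y.1 (y.2 0 0) by rewrite NN opprK.
rewrite vxN in yE dl; rewrite vyN in xE dl'.
have [xi _ _] := px.1; have N1 := normal1 tableQ xi.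
have ll' : l = l'.
  move: xE; rewrite yE /inner_normal /= NN scalerN -addrA -scalerBl => E.
  have : (l - l') *: normal Q x.1 (x.2 0 0) = 0.
    by apply: (addrI (position T x)); rewrite addr0 -E.
  move/(congr1 (fun v => dot v (normal Q x.1 (x.2 0 0)))).
  by rewrite dotZl N1 mulr1 /dot !mxE !mul0r addr0; lra.
exists l; split.
- by split => //; [case: px|case: py].
- by rewrite ll'; split => //; [case: py|case: px].
have -> : position Q y - position Q x = (l + 2 * r) *: normal Q x.1 (x.2 0 0).
  have E : position Q y + r *: normal Q y.1 (y.2 0 0) = position Q x +
      r *: normal Q x.1 (x.2 0 0) + l *: normal Q x.1 (x.2 0 0) by exact: yE.
  have -> : position Q y = position Q x + r *: normal Q x.1 (x.2 0 0) +
      l *: normal Q x.1 (x.2 0 0) - r *: normal Q y.1 (y.2 0 0) by rewrite -E addrK.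
  by rewrite NN; apply: row2P; rewrite !mxE; ring.
rewrite /enorm dotZl dotC dotZl N1 mulr1 -expr2 sqrtr_sqr ger0_norm //.
by rewrite addr_ge0 ?mulr_ge0 ?ltW.
Qed.

End period_two.

(** * Stability in the three ranges of the radius *)

Theorem mainTheorem4 (R : realType) (n : nat) (Q : table R n)
    (x y : state R n) (L R1 R2 : R)
    (tableQ : billiard_table Q)
    (nicQ : no_internal_corners Q)
    (orbit_xy : period_two_orbit Q x y)
    (focusing_x : focusing Q x.1)
    (focusing_y : focusing Q y.1)
    (defL : L = enorm (position Q y - position Q x))
    (defR1 : R1 = radius_of_curvature Q x.1 (x.2 0 0))
    (defR2 : R2 = radius_of_curvature Q y.1 (y.2 0 0))
    (gtR1R2 : R1 > R2)
    (ltL : L < R1 + R2)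
    (gtLR1 : L > R1)
    (gtLR2 : L > R2)
    (ltL2 : L < 2 * R2) :
  forall r : R, 0 < r < L / 2 ->
    period_two_orbit (reduced_table Q r) x y ->
    [/\ r < L - R1 -> linearly_stable (reduced_table Q r) x,
        L - R1 < r < L - R2 -> unstable (reduced_table Q r) x &
        L - R2 < r -> linearly_stable (reduced_table Q r) x].
Proof.
move=> r /andP[r0 rL] orbit.
have xi : interior_param Q x.1 (x.2 0 0) by case: orbit => -[[[]]].
have yi : interior_param Q y.1 (y.2 0 0) by case: orbit => -[_ [[]]].
have kx : 0 < curvature Q x.1 (x.2 0 0) by apply/focusing_x/interior_closed.
have ky : 0 < curvature Q y.1 (y.2 0 0) by apply/focusing_y/interior_closed.
have R10 : 0 < R1 by rewrite defR1 invr_gt0.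
have R20 : 0 < R2 by rewrite defR2 invr_gt0.
have kxE : curvature Q x.1 (x.2 0 0) = R1^-1 by rewrite defR1 invrK.
have kyE : curvature Q y.1 (y.2 0 0) = R2^-1 by rewrite defR2 invrK.
(* The disk is smaller than both radii of curvature: r < L / 2 < R2 < R1. This makes both speeds
   positive. *)
have d1 : 0 < R1 - r by lra.
have d2 : 0 < R2 - r by lra.
have n1 := lt0r_neq0 R10; have n2 := lt0r_neq0 R20.
have m1 := lt0r_neq0 d1; have m2 := lt0r_neq0 d2.
have bxE : speed Q r x.1 (x.2 0 0) = (R1 - r) / R1.
  by rewrite /speed kxE; field.
have byE : speed Q r y.1 (y.2 0 0) = (R2 - r) / R2.
  by rewrite /speed kyE; field.
have bx : 0 < speed Q r x.1 (x.2 0 0) by rewrite bxE divr_gt0.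
have bY : 0 < speed Q r y.1 (y.2 0 0) by rewrite byE divr_gt0.
have [l [xy yx]] := period_two_chord tableQ r0 orbit bx bY.
rewrite -defL => LE.
have [A [dA detA]] := derivative2_chord tableQ r0 xy yx.
rewrite bxE byE kxE kyE.
set p := (R1 + r - L) * (R2 + r - L) / ((R1 - r) * (R2 - r)).
(* Since l = L - 2 r, each numerator R - r - l becomes R + r - L. *)
have -> : 4 * ((R1 - r) / R1 - l * R1^-1) * ((R2 - r) / R2 - l * R2^-1) /
    ((R1 - r) / R1 * ((R2 - r) / R2)) - 2 = 4 * p - 2.
  by rewrite /p LE; field; rewrite n1 n2 m1 m2.
move=> trA.
have dd : 0 < (R1 - r) * (R2 - r) by rewrite mulr_gt0.
have stable : 0 < p < 1 -> linearly_stable (reduced_table Q r) x.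
  move=> /andP[p0 p1]; exists A => //; apply: conj_eigenvalues_mx2 => //.
  by rewrite trA; lra.
split=> [h|/andP[h h']|h].
(* Both factors of the numerator are negative, and L < R1 + R2 gives L - R1 - r < R2 - r and L - R2
   - r < R1 - r. *)
- apply: stable; rewrite /p ltr_pdivlMr // ltr_pdivrMr // mul0r mul1r.
  by apply/andP; split; nra.
- exists A => //; apply: expanding_eigenvalue_mx2 => //.
  (* Between the two thresholds the factor with R1 is positive and the one with R2 negative. *)
  have : p < 0 by rewrite /p ltr_pdivrMr // mul0r; nra.
  by rewrite trA; lra.
(* Now both factors are positive, and r < L / 2 makes each R + r - L smaller than R - r. *)
- apply: stable; rewrite /p ltr_pdivlMr // ltr_pdivrMr // mul0r mul1r.
  by apply/andP; split; nra.
Qed.
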